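(* For every $n\ge 0$, the homomorphism $u:Ab(CD_{\le n})\to U_n(VTK)$, sending a chord diagram with directed chords to the class of its corresponding unitary braided Gauss diagram, is surjective. Thus $U_n(VTK)$ is finitely generated.
   Context: **Words.** For $m\ge1$, $W_m$ is the set of words in the symbols $\sigma_1^{\pm1},\dots,\sigma_{m-1}^{\pm1},v_1,\dots,v_{m-1}$ (crossings and virtual crossings of $m$-strand virtual braids), and $W_m^1\subseteq W_m$ is the subset of words whose braid closure has one component. **Braided Gauss diagrams.** $S^1$ is the unit complex numbers. A braided Gauss diagram is a triple $(m,C,s)$: $m\ge1$ an integer (the braid index), $C$ a finite set of pairwise disjoint ordered pairs of (distinct) points of $S^1$ (chords, directed from first to second point) with $x^m=y^m$ for all $(x,y)\in C$, and $s:C\to\{+1,-1\}$ a sign function. Two diagrams $(m,C,s)$ and $(m,C',s')$ are equivalent if there is a homotopy $h:S^1\times[0,1]\to S^1$ with $h(\cdot,0)=\mathrm{id}$, each $h(\cdot,t)$ a homeomorphism, $h(x,t)^m=h(y,t)^m$ for all $t$ and $(x,y)\in C$, $C'=\{(h(x,1),h(y,1)):(x,y)\in C\}$ and $s'(h(x,1),h(y,1))=s(x,y)$. Diagrams are considered up to equivalence. Equivalently one thinks of $S^1$ as a circle of total length $m$, and the arcs between the two endpoints of each chord have integer length. **The map $w\mapsto[w]$.** For $w\in W_m^1$, identify the closed virtual braid (one component winding $m$ times) with $S^1$ so that projection to the braid direction is $z\mapsto z^m$. Each letter $\sigma_i^{\pm1}$ gives a chord from the over-crossing point to the under-crossing point,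 with sign $\pm1$; letters $v_i$ give no chord. (In $\sigma_i$ the strand passing from position $i$ to position $i+1$ is the over-strand; in $\sigma_i^{-1}$ it is the under-strand.) **$U_n(VTK)$** is the abelian group generated by (equivalence classes of) braided Gauss diagrams with at most $n$ chords, of all braid indices, modulo the following relations, for all $m$, where diagrams with more than $n$ chords are set to zero: (1) for $w\in W_m$ and $i$ with $\sigma_i\sigma_{i+1}\sigma_iw\in W_m^1$: $$[\sigma_i\sigma_{i+1}v_iw]+[v_i\sigma_{i+1}\sigma_iw]+[\sigma_iv_{i+1}\sigma_iw]+[\sigma_i\sigma_{i+1}\sigma_iw]-[\sigma_{i+1}\sigma_iv_{i+1}w]-[v_{i+1}\sigma_i\sigma_{i+1}w]-[\sigma_{i+1}v_i\sigma_{i+1}w]-[\sigma_{i+1}\sigma_i\sigma_{i+1}w]=0;$$ (2) for $w\in W_m^1$ and any index $i$: $[w\sigma_i\sigma_i^{-1}]+[w\sigma_iv_i]+[wv_i\sigma_i^{-1}]=0$ and $[w\sigma_i^{-1}\sigma_i]+[w\sigma_i^{-1}v_i]+[wv_i\sigma_i]=0$; (3) for $w\in W_m^1$: $[\sigma_mw]+[v_mw]-[w]=0$, with $\sigma_mw,v_mw\in W_{m+1}^1$. **Unitary diagrams and $u$.** $CD$ is the set of ordinary chord diagrams on the circle with directed chords (up to orientation-preserving homeomorphism of the circle), and $Ab(CD_{\le n})$ is the free abelian group on those with at most $n$ chords. A chord diagram with $k\ge1$ chords corresponds to the unitary braided Gauss diagram of braid index $2k$ with the same chords, all of positive sign, in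 which any two adjacent chord endpoints are at distance exactly one (on the circle of length $2k$). The chord diagram with no chords corresponds to the braided Gauss diagram with no chords and braid index $1$. *)

(* Defs.v *)
From HB Require Import structures.
From mathcomp Require Import all_boot all_order all_algebra.
From mathcomp Require Import finmap.
From mathcomp Require Import generic_quotient ring_quotient freeg complex.
From mathcomp Require Import all_classical all_reals all_analysis.
From mathcomp Require Import zify ring lra.
Import Order.TTheory GRing.Theory Num.Theory.
Import numFieldNormedType.Exports.

Set Implicit Arguments.
Unset Strict Implicit.
Unset Printing Implicit Defensive.

Local Open Scope fset_scope.
Local Open Scope classical_set_scope.
Local Open Scope ring_scope.
Local Open Scope quotient_scope.

(* Complex numbers, retyped as a numClosedFieldType so that they inherit the
   topology mathcomp-analysis puts on every numFieldType. *)
Definition Cplx (R : realType) : numClosedFieldType := complex R.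

Definition S1 (R : realType) : set (Cplx R) := [set z | `|z| = 1].

(* e^(2 i pi t): the circle is parametrised with total length 1. *)
Definition circ (R : realType) (t : R) : Cplx R :=
  (cos (2 * pi * t) +i* sin (2 * pi * t))%C.

Definition homeo_on (T : topologicalType) (A : set T) (f : T -> T) : Prop :=
  exists g : T -> T,
    [/\ {within A, continuous f}, {within A, continuous g},
        (forall x, A x -> A (f x) /\ g (f x) = x)
      & (forall x, A x -> A (g x) /\ f (g x) = x)].

(* Orientation is read on the universal cover: f preserves it iff it lifts to
   an increasing homeomorphism of the line. *)
Definition oriented_homeo (R : realType) (f : Cplx R -> Cplx R) : Prop :=
  homeo_on (@S1 R) f /\
  exists F : R -> R,
    [/\ homeo_on [set: R] F, {homo F : s t / s < t}
      & forall t, f (circ t) = circ (F t)].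

Definition chord (R : realType) := (Cplx R * Cplx R)%type.

Definition ends (R : realType) (c : chord R) : {fset Cplx R} := [fset c.1; c.2]%fset.

Record chord_diagram (R : realType) := ChordDiagram {
  chords : {fset chord R};
  chords_wf : forall c, c \in chords -> [/\ S1 c.1, S1 c.2 & c.1 <> c.2];
  chords_disj : forall c d x, c \in chords -> d \in chords ->
    x \in ends c -> x \in ends d -> c = d }.

HB.instance Definition _ (R : realType) := gen_eqMixin (chord_diagram R).
HB.instance Definition _ (R : realType) := gen_choiceMixin (chord_diagram R).

Definition empty_diagram (R : realType) : chord_diagram R.
Proof. by apply: (@ChordDiagram R fset0) => [c|c d x]; rewrite in_fset0. Defined.

Definition image_chords (R : realType) (f : Cplx R -> Cplx R)
    (C : {fset chord R}) : {fset chord R} :=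
  [fset (f c.1, f c.2) | c in C].

(* [sign D] is +1 for [true] and -1 for [false]; its values off [chords] are
   meaningless and are ignored by [gd_equiv]. *)
Record gauss_diagram (R : realType) := GaussDiagram {
  braid_index : nat;
  diagram : chord_diagram R;
  sign : chord R -> bool;
  index_gt0 : (0 < braid_index)%N;
  chords_pow : forall c, c \in chords diagram ->
    c.1 ^+ braid_index = c.2 ^+ braid_index }.

HB.instance Definition _ (R : realType) := gen_eqMixin (gauss_diagram R).
HB.instance Definition _ (R : realType) := gen_choiceMixin (gauss_diagram R).

Definition empty_gauss (R : realType) : gauss_diagram R.
Proof.
by apply: (@GaussDiagram R 1 (empty_diagram R) xpredT) => // c; rewrite in_fset0.
Defined.

HB.instance Definition _ (R : realType) :=
  isPointed.Build (gauss_diagram R) (empty_gauss R).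

Definition cd_equiv (R : realType) (c c' : chord_diagram R) : Prop :=
  exists2 f, oriented_homeo f & chords c' = image_chords f (chords c).

Definition gd_equiv (R : realType) (D D' : gauss_diagram R) : Prop :=
  braid_index D = braid_index D' /\
  exists h : Cplx R -> R -> Cplx R,
    [/\ {within @S1 R `*` `[0, 1]%classic, continuous (fun p => h p.1 p.2)},
        (forall x, S1 x -> h x 0 = x),
        (forall t, 0 <= t <= 1 -> homeo_on (@S1 R) (h^~ t)),
        (forall c t, c \in chords (diagram D) -> 0 <= t <= 1 ->
           h c.1 t ^+ braid_index D = h c.2 t ^+ braid_index D)
      & chords (diagram D') = image_chords (h^~ 1) (chords (diagram D)) /\
        (forall c, c \in chords (diagram D) ->
           sign D' (h c.1 1, h c.2 1) = sign D c)].

Lemma within_comp (T U V : topologicalType) (A : set T) (B : set U)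
    (f : T -> U) (g : U -> V) :
  (forall x, A x -> B (f x)) ->
  {within A, continuous f} -> {within B, continuous g} ->
  {within A, continuous (g \o f)}.
Proof.
move=> AB /subspace_continuousP cf /subspace_continuousP cg.
apply/subspace_continuousP => x Ax.
move=> P /(cg _ (AB _ Ax)) /(cf _ Ax) /= WP.
have {}WP : \forall y \near x, A y -> B (f y) -> P (g (f y)) := WP.
change (\forall y \near x, A y -> P (g (f y))).
by apply: filterS WP => y WPy Ay; exact: WPy (AB _ Ay).
Qed.

Arguments within_comp {T U V A B f g} _ _ _.

Lemma homeo_on_id (T : topologicalType) (A : set T) : homeo_on A id.
Proof.
by exists id; split => //; apply: continuous_subspaceT => x; exact: cvg_id.
Qed.

Lemma homeo_on_comp (T : topologicalType) (A : set T) (f g : T -> T) :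
  homeo_on A f -> homeo_on A g -> homeo_on A (g \o f).
Proof.
move=> [f' [cf cf' fK f'K]] [g' [cg cg' gK g'K]]; exists (f' \o g'); split.
- by apply: within_comp cf cg => x /fK[].
- by apply: within_comp cg' cf' => x /g'K[].
- move=> x Ax /=; have [Afx fx] := fK x Ax; have [Agx gx] := gK _ Afx.
  by split => //; rewrite gx.
- move=> x Ax /=; have [Agx gx] := g'K x Ax; have [Afx fx] := f'K _ Agx.
  by split => //; rewrite fx.
Qed.

Lemma homeo_on_eq (T : topologicalType) (A : set T) (f g : T -> T) :
  (forall x, A x -> f x = g x) -> homeo_on A f -> homeo_on A g.
Proof.
move=> fg [f' [cf cf' fK f'K]]; exists f'; split => //.
- apply: subspace_eq_continuous cf => x; rewrite inE => Ax; exact: fg.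
- by move=> x Ax; rewrite -fg //; exact: fK.
- by move=> x Ax; have [? ?] := f'K x Ax; rewrite -fg.
Qed.

Lemma image_chords_comp (R : realType) (f g : Cplx R -> Cplx R) C :
  image_chords g (image_chords f C) = image_chords (g \o f) C.
Proof.
apply/fsetP => c; apply/imfsetP/imfsetP => /=.
- by move=> [_ /imfsetP[d /= dC ->] ->]; exists d.
- move=> [d dC ->]; exists (f d.1, f d.2) => //.
  by apply/imfsetP; exists d.
Qed.

Lemma image_chords_id (R : realType) (f : Cplx R -> Cplx R)
    (D : chord_diagram R) :
  (forall x, S1 x -> f x = x) -> image_chords f (chords D) = chords D.
Proof.
move=> fid; apply/fsetP => c; apply/imfsetP/idP => /=.
- by move=> [d dD ->]; have [d1 d2 _] := chords_wf dD; rewrite !fid // -surjective_pairing.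
- move=> cD; exists c => //; have [d1 d2 _] := chords_wf cD.
  by rewrite !fid // -surjective_pairing.
Qed.
Lemma circ_S1 (R : realType) (t : R) : S1 (circ t).
Proof.
change (`|circ t : complex R| = 1).
by rewrite normc_def /= cos2Dsin2 sqrtr1.
Qed.

Lemma circ0 (R : realType) : circ (0 : R) = 1.
Proof. by rewrite /circ mulr0 cos0 sin0. Qed.

Lemma circD (R : realType) (s t : R) : circ (s + t) = circ s * circ t.
Proof.
change (circ (s + t) = (circ s : complex R) * (circ t : complex R)).
rewrite /circ mulrDr cosD sinD.
by congr (_ +i* _)%C; ring.
Qed.

Lemma circX (R : realType) (t : R) m : circ t ^+ m = circ (m%:R * t).
Proof.
elim: m => [|m IH]; first by rewrite mul0r circ0.
by rewrite exprS IH -circD -natr1; congr circ; ring.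
Qed.

Lemma circ_nat (R : realType) (k : nat) : circ (k%:R : R) = 1.
Proof.
rewrite -[k%:R]mulr1 -circX.
suff -> : circ (1 : R) = 1 by rewrite expr1n.
have e : 2 * pi * 1 = pi *+ 2 :> R by rewrite mulr1 mulr_natl.
by rewrite /circ e cos2pi -[pi *+ 2]add0r sinD2pi sin0.
Qed.

Lemma circ_inj (R : realType) (s t : R) :
  0 <= s < 1 -> 0 <= t < 1 -> circ s = circ t -> s = t.
Proof.
wlog st : s t / s <= t.
  by move=> H; case: (leP s t) => [/H//|/ltW/H{}H ? ? e]; rewrite H.
move=> /andP[s0 s1] /andP[t0 t1] e; apply/eqP; apply: contraTT isT => nst.
have {st nst}st : s < t by rewrite lt_neqAle nst.
have [d d0 td] : exists2 d, 0 < d < 1 & t = s + d.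
  by exists (t - s); [rewrite subr_gt0 st /=; lra|ring].
have cs0 : circ s != 0.
  by apply/eqP => c0; have := circ_S1 s; rewrite /S1 /= c0 normr0 => /esym/eqP; rewrite oner_eq0.
have cd : circ d = 1.
  by apply: (mulfI cs0); rewrite -circD -td mulr1.
have pi0 := pi_gt0 R.
have [dc ds] : cos (2 * pi * d) = 1 /\ sin (2 * pi * d) = 0 by case: cd.
have : sin (pi * d) ^+ 2 = 0.
  have e2 : (pi * d) *+ 2 = 2 * pi * d by rewrite -mulr_natl mulrA.
  by have := cos_mulr2n (pi * d); rewrite e2 dc cos2sin2; lra.
move=> /eqP; rewrite expf_eq0 /= => /eqP sd.
have : 0 < sin (pi * d); last by rewrite sd ltxx.
by apply: sin_gt0_pi; case/andP: d0 => ? ?; rewrite mulr_gt0 //= gtr_pMr.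
Qed.

Lemma oriented_homeo_id (R : realType) : oriented_homeo (@id (Cplx R)).
Proof. by split; [exact: homeo_on_id|exists id; split => //; exact: homeo_on_id]. Qed.

Lemma cd_equiv_refl (R : realType) (c : chord_diagram R) : cd_equiv c c.
Proof.
by exists id; [exact: oriented_homeo_id|rewrite image_chords_id].
Qed.

Lemma cd_equiv_sym (R : realType) (c c' : chord_diagram R) :
  cd_equiv c c' -> cd_equiv c' c.
Proof.
move=> [f [[g [cf cg fK gK]] [F [[G [cF cG FK GK]] incF fF]]] cc']; exists g.
  split; first by exists f; split.
  exists G; split.
  - by exists F; split.
  - move=> s t st; rewrite ltNge; apply/negP => tsG.
    have [_ Gs] := GK s I; have [_ Gt] := GK t I.
    move: tsG; rewrite le_eqVlt => /predU1P[e|/incF].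
      by move: st; rewrite -Gs -e Gt ltxx.
    by rewrite Gs Gt => /(lt_trans st); rewrite ltxx.
  - move=> t; have [_ {1}<-] := GK t I.
    by rewrite -fF; case: (fK _ (circ_S1 (G t))).
rewrite cc' image_chords_comp image_chords_id // => x Sx /=.
by case: (fK x Sx).
Qed.

Lemma cd_equiv_trans (R : realType) (c1 c2 c3 : chord_diagram R) :
  cd_equiv c1 c2 -> cd_equiv c2 c3 -> cd_equiv c1 c3.
Proof.
move=> [f [hf [F [hF incF fF]]] e2] [g [hg [G [hG incG gG]]] e3].
exists (g \o f); last by rewrite e3 e2 image_chords_comp.
split; first exact: homeo_on_comp.
exists (G \o F); split; first exact: homeo_on_comp.
- by move=> s t /incF/incG.
- by move=> t /=; rewrite fF gG.
Qed.

Lemma gd_equiv_refl (R : realType) (D : gauss_diagram R) : gd_equiv D D.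
Proof.
split => //; exists (fun x _ => x); split => //.
- by apply: continuous_subspaceT => x; exact: cvg_fst.
- by move=> t _; exact: homeo_on_id.
- by move=> c t cD _; exact: chords_pow.
- by split; [rewrite image_chords_id|move=> c _; rewrite -surjective_pairing].
Qed.

Lemma within_continuous_pair (T U V : topologicalType) (A : set T)
    (f : T -> U) (g : T -> V) :
  {within A, continuous f} -> {within A, continuous g} ->
  {within A, continuous (fun x => (f x, g x))}.
Proof.
move=> /subspace_continuousP cf /subspace_continuousP cg.
apply/subspace_continuousP => x Ax.
by apply: cvg_pair; [exact: cf|exact: cg].
Qed.

Lemma within_continuous_fst (T U V : topologicalType) (A : set T) (B : set U)
    (g : T -> V) :
  {within A, continuous g} ->
  {within A `*` B, continuous (fun p : T * U => g p.1)}.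
Proof.
move=> cg.
have cfst : {within A `*` B, continuous (@fst T U)}.
  by apply: continuous_subspaceT => x; exact: cvg_fst.
have AB p : (A `*` B) p -> A p.1 by case.
exact: (within_comp AB cfst cg).
Qed.

Lemma closed_prod (T U : topologicalType) (A : set T) (B : set U) :
  closed A -> closed B -> closed (A `*` B).
Proof.
move=> cA cB; have -> : A `*` B = (fst @^-1` A) `&` (snd @^-1` B) by [].
apply: closedI; apply: closed_comp => // -[x y] _; [exact: cvg_fst|exact: cvg_snd].
Qed.

Lemma closed_S1 (R : realType) : closed (@S1 R).
Proof.
have -> : @S1 R = Num.norm @^-1` [set (1 : Cplx R)] by [].
by apply: closed_comp => [x _|]; [exact: norm_continuous|apply: accessible_closed_set1; apply: hausdorff_accessible; exact: norm_hausdorff].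
Qed.

Lemma gd_equiv_sym (R : realType) (D D' : gauss_diagram R) :
  gd_equiv D D' -> gd_equiv D' D.
Proof.
move=> [eI [h [ch h0 hh hp [eC eS]]]]; split => //.
have /hh[g [ch1 cg hK gK]] : (0 : R) <= (1 : R) <= 1 by rewrite ler01 lexx.
have S c : c \in chords (diagram D) -> g (h c.1 1) = c.1 /\ g (h c.2 1) = c.2.
  by move=> cD; have [c1 c2 _] := chords_wf cD; split; apply: (hK _ _).2.
exists (fun x t => h (g x) (1 - t)); split.
- have H : {within @S1 R `*` `[0, 1]%classic,
      continuous (fun p : Cplx R * R => (g p.1, 1 - p.2))}.
    apply: within_continuous_pair.
      exact: within_continuous_fst.
    apply: continuous_subspaceT => x; apply: cvgB; [exact: cvg_cst|exact: cvg_snd].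
  have H01 (p : Cplx R * R) : (@S1 R `*` `[0, 1]%classic) p ->
      (@S1 R `*` `[0, 1]%classic) (g p.1, 1 - p.2).
    case: p => x t [/= /gK[Sx _] t01].
    by split => //=; move: t01; rewrite !in_itv /= => /andP[? ?]; lra.
  exact: (within_comp H01 H ch).
- by move=> x /gK[_]; rewrite subr0.
- move=> t t01; apply: (@homeo_on_comp _ _ g (h^~ (1 - t))).
    by exists (h^~ 1); split; [exact: cg|exact: ch1|exact: gK|exact: hK].
  by apply: hh; move: t01 => /andP[? ?]; lra.
- move=> c' t; rewrite eC => /imfsetP[c cD /= ->] /=; rewrite -eI => t01.
  have [-> ->] := S _ cD; apply: hp => //; move: t01 => /andP[? ?]; lra.
- split; rewrite eC.
    rewrite image_chords_comp; apply/fsetP => c; apply/idP/imfsetP.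
      by move=> cD; exists c => //=; have [-> ->] := S _ cD; have [c1 c2 _] := chords_wf cD; rewrite subrr !h0 -?surjective_pairing.
    by move=> [d dD ->] /=; have [-> ->] := S _ dD; have [c1 c2 _] := chords_wf dD; rewrite subrr !h0 -?surjective_pairing.
  move=> c' /imfsetP[c cD /= ->] /=; have [-> ->] := S _ cD.
  have [c1 c2 _] := chords_wf cD; rewrite subrr !h0 // -surjective_pairing.
  by rewrite eS.
Qed.

Lemma gd_equiv_trans (R : realType) (D1 D2 D3 : gauss_diagram R) :
  gd_equiv D1 D2 -> gd_equiv D2 D3 -> gd_equiv D1 D3.
Proof.
move=> [eI [h [ch h0 hh hp [eC eS]]]] [eI' [k [ck k0 kh kp [eC' eS']]]].
split; first by rewrite eI.
pose H x t := if t <= 2^-1 then h x (2 * t) else k (h x 1) (2 * t - 1).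
have S1h x t : S1 x -> 0 <= t <= 1 -> S1 (h x t).
  by move=> Sx /hh[g [_ _ hK _]]; exact: (hK _ Sx).1.
have H1 x : H x 1 = k (h x 1) 1.
  by rewrite /H ifF; [congr k; ring|apply/negbTE; rewrite -ltNge; lra].
have H2 x t : S1 x -> 2^-1 <= t -> H x t = k (h x 1) (2 * t - 1).
  move=> Sx t2; rewrite /H; case: ifP => // t2'.
  have -> : t = 2^-1 by lra.
  have -> : 2 * 2^-1 = 1 :> R by field.
  by rewrite subrr k0 //; apply: S1h => //; rewrite ler01 lexx.
exists H; split.
- have -> : @S1 R `*` `[0, 1]%classic =
      (@S1 R `*` `[0, 2^-1]%classic) `|` (@S1 R `*` `[2^-1, 1]%classic) :> set (Cplx R * R).
    rewrite eqEsubset; split => -[x t] /=; rewrite !in_itv /=.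
      move=> [Sx /andP[t0 t1]]; have [t2|/ltW t2] := leP t 2^-1.
        by left; split => //; apply/andP.
      by right; split => //; apply/andP.
    by move=> [|] [Sx /andP[t0 t1]]; split => //; lra.
  apply: withinU_continuous.
  + by apply: closed_prod; [exact: closed_S1|exact: itv_closed].
  + by apply: closed_prod; [exact: closed_S1|exact: itv_closed].
  + pose q (p : Cplx R * R) := (p.1, 2 * p.2).
    have cq : {within @S1 R `*` `[0, 2^-1]%classic, continuous q}.
      apply: within_continuous_pair; apply: continuous_subspaceT => x.
        exact: cvg_fst.
      by apply: cvgM; [exact: cvg_cst|exact: cvg_snd].
    have := within_comp _ cq ch.
    have q01 (p : Cplx R * R) : (@S1 R `*` `[0, 2^-1]%classic) p -> (@S1 R `*` `[0, 1]%classic) (q p).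
      by case: p => x t /= []; rewrite !in_itv /= => Sx /andP[? ?]; split => //; lra.
    move=> /(_ q01); apply: subspace_eq_continuous => -[x t].
    rewrite inE /= in_itv /= => -[Sx /andP[t0 t2]].
    by rewrite /from_subspace /= /H t2.
  + pose q (p : Cplx R * R) := (h p.1 1, 2 * p.2 - 1).
    have cq : {within @S1 R `*` `[2^-1, 1]%classic, continuous q}.
      apply: within_continuous_pair.
        have /hh[g [ch1 cg hK gK]] : (0 : R) <= (1 : R) <= 1 by rewrite ler01 lexx.
        exact: within_continuous_fst ch1.
      apply: continuous_subspaceT => x; apply: cvgB; last exact: cvg_cst.
      by apply: cvgM; [exact: cvg_cst|exact: cvg_snd].
    have := within_comp _ cq ck.
    have q01 (p : Cplx R * R) : (@S1 R `*` `[2^-1, 1]%classic) p -> (@S1 R `*` `[0, 1]%classic) (q p).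
      case: p => x t /= []; rewrite !in_itv /= => Sx /andP[? ?]; split; last lra.
      by apply: S1h => //; rewrite ler01 lexx.
    move=> /(_ q01); apply: subspace_eq_continuous => -[x t].
    rewrite inE /= in_itv /= => -[Sx /andP[t2 t1]].
    by rewrite /from_subspace /= H2.
- by move=> x Sx; rewrite /H mulr0 ifT ?h0 //; lra.
- move=> t /andP[t0 t1]; rewrite /H; case: (leP t 2^-1) => t2.
    by apply: hh; lra.
  apply: (@homeo_on_comp _ _ (h^~ 1) (k^~ (2 * t - 1))).
    by apply: hh; lra.
  by apply: kh; lra.
- move=> c t cD /andP[t0 t1]; rewrite /H; case: (leP t 2^-1) => t2.
    by apply: hp => //; lra.
  rewrite eI; apply: (kp (h c.1 1, h c.2 1)); last by lra.
  by rewrite eC; apply/imfsetP; exists c.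
- split.
    rewrite eC' eC image_chords_comp; apply/fsetP => c.
    by apply/imfsetP/imfsetP => -[d dD ->]; exists d => //=; rewrite !H1.
  move=> c cD; rewrite !H1 -(eS _ cD).
  by apply: (eS' (h c.1 1, h c.2 1)); rewrite eC; apply/imfsetP; exists c.
Qed.

(* [Crossing i true] is sigma_i, [Crossing i false] its inverse, [Virtual i]
   is v_i; strand positions are numbered 1, ..., m. *)
Inductive letter := Crossing of nat & bool | Virtual of nat.

Definition word := seq letter.

Definition letter_index (l : letter) : nat :=
  match l with Crossing i _ => i | Virtual i => i end.

Definition strand_swap (i p : nat) : nat :=
  if p == i then i.+1 else if p == i.+1 then i else p.

(* Final position of the strand that enters [w] at position [p]; words are
   read from left to right in the direction of the braid. *)
Definition track (w : word) (p : nat) : nat :=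
  foldl (fun q l => strand_swap (letter_index l) q) p w.

Definition in_W (m : nat) (w : word) : Prop :=
  (0 < m)%N /\ all (fun l => 0 < letter_index l < m)%N w.

(* The components of the closure are the orbits of [track w]. *)
Definition in_W1 (m : nat) (w : word) : Prop :=
  in_W m w /\
  forall p q, (0 < p <= m)%N -> (0 < q <= m)%N ->
    exists k, iter k (track w) p = q.

(* Follow the closed braid from position 1 at the start of [w]: [lap m w j p]
   is the number of complete turns made before reaching position [p] just
   before the [j]-th letter (letters are numbered from 0). *)
Definition lap (m : nat) (w : word) (j p : nat) : nat :=
  seq.index p [seq track (take j w) q | q <- traject (track w) 1 m].

(* The j-th letter lies over e^(2 i pi j / size w) under z |-> z^m. *)
Definition word_point (R : realType) (m : nat) (w : word) (j p : nat) :
    Cplx R :=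
  circ ((lap m w j p * size w + j)%:R / (m * size w)%:R).

(* The over-strand enters sigma_i at position i and sigma_i^-1 at i+1. *)
Definition word_chord (R : realType) (m : nat) (w : word) (j : nat) :
    option (chord R) :=
  match nth (Virtual 0) w j with
  | Crossing i true => Some (word_point R m w j i, word_point R m w j i.+1)
  | Crossing i false => Some (word_point R m w j i.+1, word_point R m w j i)
  | Virtual _ => None
  end.

Definition word_chords (R : realType) (m : nat) (w : word) :
    {fset chord R} :=
  [fset c in pmap (word_chord R m w) (iota 0 (size w))]%fset.

Definition word_sign (R : realType) (m : nat) (w : word) (c : chord R) : bool :=
  has (fun j => (if nth (Virtual 0) w j is Crossing _ true then true else false)
                && (word_chord R m w j == Some c)) (iota 0 (size w)).

Lemma strand_swapK i : involutive (strand_swap i).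
Proof.
move=> p; rewrite /strand_swap; case: (eqVneq p i) => [->|pi].
  by rewrite eqxx ifF //; apply/negbTE; rewrite gtn_eqF.
by case: (eqVneq p i.+1) => [->|pi1]; rewrite ?eqxx // (negbTE pi) (negbTE pi1).
Qed.

Lemma track_revK w : cancel (track (rev w)) (track w).
Proof.
elim: w => // l w IH p; rewrite /track rev_cons -cats1 foldl_cat /= strand_swapK.
exact: IH.
Qed.

Lemma track_bound m w p : all (fun l => 0 < letter_index l < m)%N w ->
  (0 < p <= m)%N -> (0 < track w p <= m)%N.
Proof.
elim: w p => //= l w IH p /andP[li aw] pm; apply: IH => //.
rewrite /strand_swap; case: eqP => [|_]; last case: eqP => [|_] //; lia.
Qed.

Lemma lap_mem m w j p : in_W1 m w -> (0 < p <= m)%N ->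
  p \in [seq track (take j w) q | q <- traject (track w) 1 m].
Proof.
move=> [[m0 aw] tr] pm; pose q := track (rev (take j w)) p.
have qm : (0 < q <= m)%N.
  apply: track_bound => //; rewrite all_rev.
  by move: aw; rewrite -{1}(cat_take_drop j w) all_cat => /andP[].
apply/mapP; exists q; last by rewrite /q track_revK.
have [|k <-] := tr 1%N q _ qm; first by rewrite m0.
suff /loopingP : looping (track w) 1 m by apply.
apply: contraT; rewrite -looping_uniq => /uniq_leq_size.
move=> /(_ (iota 1 m)); rewrite size_traject size_iota ltnn; apply.
move=> _ /trajectP[i _ ->]; rewrite mem_iota add1n ltnS.
by elim: i => [|i IH] /=; [rewrite m0|exact: track_bound].
Qed.

Lemma lap_lt m w j p : in_W1 m w -> (0 < p <= m)%N -> (lap m w j p < m)%N.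
Proof.
move=> hw pm; have := lap_mem j hw pm.
by rewrite -index_mem size_map size_traject.
Qed.

Lemma lap_inj m w j p q : in_W1 m w -> (0 < p <= m)%N -> (0 < q <= m)%N ->
  lap m w j p = lap m w j q -> p = q.
Proof.
move=> hw pm qm e.
by rewrite -(nth_index 0 (lap_mem j hw pm)) -(nth_index 0 (lap_mem j hw qm)) [seq.index p _]e.
Qed.

Lemma word_point_inj (R : realType) m w j j' p p' : in_W1 m w ->
  (0 < p <= m)%N -> (0 < p' <= m)%N -> (j < size w)%N -> (j' < size w)%N ->
  word_point R m w j p = word_point R m w j' p' -> j = j' /\ p = p'.
Proof.
move=> hw pm pm' jw jw'.
have m0 := hw.1.1.
have lt a b : (a < m)%N -> (b < size w)%N -> (a * size w + b < m * size w)%N.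
  by move=> ? ?; nia.
have mw : (0 : R) < (m * size w)%:R by rewrite ltr0n muln_gt0 m0 (leq_ltn_trans _ jw).
have b01 a b : (a < m)%N -> (b < size w)%N ->
    0 <= (a * size w + b)%:R / (m * size w)%:R < (1 : R).
  by move=> am bw; rewrite divr_ge0 ?ler0n //= ltr_pdivrMr // mul1r ltr_nat lt.
move=> /circ_inj; rewrite !b01 ?lap_lt // => /(_ isT isT).
move=> /(mulIf (lt0r_neq0 _)); rewrite invr_gt0 => /(_ mw) /eqP.
rewrite eqr_nat => /eqP e.
have jj : j = j'.
  by have := congr1 (modn^~ (size w)) e; rewrite !modnMDl !modn_small.
split => //; rewrite -jj in e; apply: (lap_inj (j := j) hw) => //.
have /eqP := e; rewrite eqn_add2r eqn_pmul2r ?(leq_ltn_trans _ jw) //.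
by move/eqP.
Qed.

Lemma word_pointX (R : realType) m w j p : (0 < m)%N -> (j < size w)%N ->
  word_point R m w j p ^+ m = circ (j%:R / (size w)%:R).
Proof.
move=> m0 jw; have m0' : m%:R != 0 :> R by rewrite pnatr_eq0 -lt0n.
have w0 : (size w)%:R != 0 :> R by rewrite pnatr_eq0 -lt0n (leq_ltn_trans _ jw).
rewrite circX -[RHS]mul1r -(circ_nat R (lap m w j p)) -circD; congr circ.
by rewrite natrD !natrM; field; rewrite m0' w0.
Qed.

Lemma word_chordsP (R : realType) m w (c : chord R) : in_W m w ->
  c \in word_chords R m w ->
  exists j p q, [/\ (j < size w)%N, word_chord R m w j = Some c,
    (0 < p <= m)%N /\ (0 < q <= m)%N, p <> q
    & c = (word_point R m w j p, word_point R m w j q)].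
Proof.
move=> [_ aw]; rewrite in_fset mem_pmap => /mapP[j].
rewrite mem_iota /= add0n => jw e; exists j; rewrite -e.
have := all_nthP (Virtual 0) aw j jw.
move: e; rewrite /word_chord; case: (nth _ w j) => // i [] /= [->] im.
- by exists i, i.+1; split => //; lia.
- by exists i.+1, i; split => //; lia.
Qed.

Definition word_diagram (R : realType) (m : nat) (w : word) (hw : in_W1 m w) :
  chord_diagram R.
Proof.
apply: (@ChordDiagram R (word_chords R m w)).
- move=> c /(word_chordsP hw.1)[j [p [q [jw _ [pm qm] pq ->]]]] /=.
  split; [exact: circ_S1|exact: circ_S1|].
  by move=> /(word_point_inj hw pm qm jw jw)[].
- move=> c d x.
  move=> /(word_chordsP hw.1)[j [p [q [jw ec [pm qm] _ ce]]]].
  move=> /(word_chordsP hw.1)[k [r [s [kw ed [rm sm] _ de]]]].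
  rewrite ce de !inE => hx hx'; rewrite -ce -de.
  suff jk : j = k by move: ed; rewrite -jk ec => -[].
  move: hx hx' => /orP[] /eqP -> /orP[] /eqP;
    by move/(word_point_inj hw); case.
Defined.

Lemma word_chords_pow (R : realType) m w (hw : in_W1 m w) (c : chord R) :
  c \in chords (word_diagram R hw) -> c.1 ^+ m = c.2 ^+ m.
Proof.
move=> /(word_chordsP hw.1)[j [p [q [jw _ [pm qm] _ ->]]]] /=.
by rewrite !word_pointX // hw.1.1.
Qed.

(* The diagram [w] of a word with one-component closure; other words are sent
   to a dummy value. *)
Definition word_gauss (R : realType) (m : nat) (w : word) : gauss_diagram R :=
  match pselect (in_W1 m w) with
  | left hw => GaussDiagram (word_sign m w) hw.1.1 (@word_chords_pow R m w hw)
  | right _ => empty_gauss R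
  end.

Definition cd_rel (R : realType) : rel (chord_diagram R) :=
  fun c c' => `[< cd_equiv c c' >].

Lemma cd_relP (R : realType) : equiv_class_of (@cd_rel R).
Proof.
split=> [c|c c'|c2 c1 c3].
- by apply/asboolP; exact: cd_equiv_refl.
- by apply/asboolP/asboolP; exact: cd_equiv_sym.
- by move=> /asboolP e12 /asboolP e23; apply/asboolP; exact: cd_equiv_trans e23.
Qed.

Canonical cd_equiv_rel (R : realType) := EquivRelPack (@cd_relP R).

Definition CD (R : realType) := {eq_quot (@cd_rel R)}.

Definition gd_rel (R : realType) : rel (gauss_diagram R) :=
  fun D D' => `[< gd_equiv D D' >].

Lemma gd_relP (R : realType) : equiv_class_of (@gd_rel R).
Proof.
split=> [c|c c'|c2 c1 c3].
- by apply/asboolP; exact: gd_equiv_refl.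
- by apply/asboolP/asboolP; exact: gd_equiv_sym.
- by move=> /asboolP e12 /asboolP e23; apply/asboolP; exact: gd_equiv_trans e23.
Qed.

Canonical gd_equiv_rel (R : realType) := EquivRelPack (@gd_relP R).

Definition GD (R : realType) := {eq_quot (@gd_rel R)}.

HB.instance Definition _ (R : realType) := Choice.on (CD R).
HB.instance Definition _ (R : realType) : EqQuotient _ (@cd_rel R) (CD R) :=
  EqQuotient.on (CD R).
HB.instance Definition _ (R : realType) := Choice.on (GD R).
HB.instance Definition _ (R : realType) : EqQuotient _ (@gd_rel R) (GD R) :=
  EqQuotient.on (GD R).

Definition CD_class (R : realType) (c : chord_diagram R) : CD R := \pi c.

Definition GD_class (R : realType) (D : gauss_diagram R) : GD R := \pi D.

Definition zspan (V : zmodType) (P : set V) : {pred V} := fun x =>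
  `[< forall Q : set V, Q 0 -> (forall y z, Q y -> Q z -> Q (y - z)) ->
        P `<=` Q -> Q x >].

Lemma zspan_closed (V : zmodType) (P : set V) : zmod_closed (zspan P).
Proof.
split=> [|x y /asboolP hx /asboolP hy]; apply/asboolP => Q Q0 QB PQ //.
exact: QB (hx Q Q0 QB PQ) (hy Q Q0 QB PQ).
Qed.

HB.instance Definition _ (V : zmodType) (P : set V) :=
  GRing.isZmodClosed.Build V (zspan P) (zspan_closed P).

Definition gd_gen (R : realType) (D : gauss_diagram R) : {freeg (GD R)} :=
  << GD_class D >>.

Section Relators.
Variable R : realType.
Local Notation "[| m ; w |]" := (gd_gen (word_gauss R m w)).
Local Notation σ i := (Crossing i true).
Local Notation σ' i := (Crossing i false).
Local Notation v i := (Virtual i).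

Inductive relator (n : nat) : set {freeg (GD R)} :=
| rel_large D : (n < #|` chords (diagram D)|)%N -> relator n (gd_gen D)
| rel_three m w i : in_W m w ->
    in_W1 m ([:: σ i; σ i.+1; σ i] ++ w) ->
    relator n
      ([| m; [:: σ i; σ i.+1; v i] ++ w |]
       + [| m; [:: v i; σ i.+1; σ i] ++ w |]
       + [| m; [:: σ i; v i.+1; σ i] ++ w |]
       + [| m; [:: σ i; σ i.+1; σ i] ++ w |]
       - [| m; [:: σ i.+1; σ i; v i.+1] ++ w |]
       - [| m; [:: v i.+1; σ i; σ i.+1] ++ w |]
       - [| m; [:: σ i.+1; v i; σ i.+1] ++ w |]
       - [| m; [:: σ i.+1; σ i; σ i.+1] ++ w |])
| rel_two m w i : in_W1 m w -> (0 < i < m)%N ->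
    relator n
      ([| m; w ++ [:: σ i; σ' i] |] + [| m; w ++ [:: σ i; v i] |]
       + [| m; w ++ [:: v i; σ' i] |])
| rel_two' m w i : in_W1 m w -> (0 < i < m)%N ->
    relator n
      ([| m; w ++ [:: σ' i; σ i] |] + [| m; w ++ [:: σ' i; v i] |]
       + [| m; w ++ [:: v i; σ i] |])
| rel_stab m w : in_W1 m w ->
    relator n ([| m.+1; σ m :: w |] + [| m.+1; v m :: w |] - [| m; w |]).

End Relators.

(* The generators are all classes of diagrams; [rel_large] kills those with
   more than n chords. *)
Definition U (R : realType) (n : nat) : zmodType :=
  @Quotient.quot {freeg (GD R)} (zspan (@relator R n)).

Definition U_class (R : realType) (n : nat) (D : gauss_diagram R) : U R n :=
  \pi_(U R n) (gd_gen D).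

(* Number of chords, which does not depend on the representative. *)
Definition CD_size (R : realType) (q : CD R) : nat := #|` chords (repr q)|.

Definition AbCD (R : realType) (n : nat) : zmodType :=
  {freeg {q : CD R | (CD_size q <= n)%N}}.

Definition endpoint (R : realType) (c : chord_diagram R) : set (Cplx R) :=
  [set x | exists2 d, d \in chords c & x \in ends d].

(* Adjacent endpoints x and x e^(2 i pi t) are at distance m t on the circle of
   length m. *)
Definition unitary (R : realType) (D : gauss_diagram R) : Prop :=
  let k := #|` chords (diagram D)| in
  [/\ braid_index D = if k == 0%N then 1%N else (2 * k)%N,
      (forall c, c \in chords (diagram D) -> sign D c = true)
    & forall (x : Cplx R) (t : R), 0 < t < 1 ->
        endpoint (diagram D) x -> endpoint (diagram D) (x * circ t) ->
        (forall s, 0 < s < t -> ~ endpoint (diagram D) (x * circ s)) ->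
        (braid_index D)%:R * t = 1].

(* The unitary diagram with the chords of [q]; it is unique up to [gd_equiv]. *)
Definition unitary_of (R : realType) (q : CD R) : gauss_diagram R :=
  get [set D | unitary D /\ CD_class (diagram D) = q].

Definition u (R : realType) (n : nat) : AbCD R n -> U R n :=
  fglift (fun q : {q : CD R | (CD_size q <= n)%N} =>
            U_class n (unitary_of (val q)) : zmodule (U R n)).

Lemma u_additive (R : realType) (n : nat) : additive (@u R n).
Proof.
move=> x y.
exact: (@lift_is_additive int _ (zmodule (U R n))
  (fun q => U_class n (unitary_of (val q)))).
Qed.

HB.instance Definition _ (R : realType) (n : nat) :=
  GRing.isAdditive.Build (AbCD R n) (U R n) (@u R n) (@u_additive R n).

Definition finitely_generated (V : zmodType) : Prop :=
  exists s : seq V, forall x : V, exists a : nat -> int,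
    x = \sum_(i < size s) s`_i *~ a i.

(* Main.v *)
(* Modulo diagrams with more chords, relation (2) identifies, up to sign, a
   diagram with the one obtained by reversing the sign of a chord, and relation
   (3) allows a unit length to be inserted into, or removed from, any arc.
   Insert one unit before each endpoint: every unit interval of the circle of
   length m then contains at most one endpoint, so that all the endpoints can be
   slid to integer points by a homotopy; removing the superfluous units leaves a
   unitary diagram. Downward induction on the number of chords concludes. *)

Require Import Defs.
From HB Require Import structures.
From mathcomp Require Import all_boot all_order all_algebra.
From mathcomp Require Import finmap.
From mathcomp Require Import generic_quotient ring_quotient freeg complex.
From mathcomp Require Import all_classical all_reals all_analysis.
From mathcomp Require Import zify ring lra.
Import Order.TTheory GRing.Theory Num.Theory.
Import numFieldNormedType.Exports.

Set Implicit Arguments.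
Unset Strict Implicit.
Unset Printing Implicit Defensive.

Local Open Scope fset_scope.
Local Open Scope classical_set_scope.
Local Open Scope ring_scope.
Local Open Scope quotient_scope.

(** * Topology of the circle *)

Section CircleTopology.
Variable R : realType.
Implicit Types (s t x y : R) (z : Cplx R).

(** The relations speak of closures of words in which the relevant letters stand at fixed places,
    while the reduction has to act at an arbitrary point of an arbitrary diagram. The bridge is the
    code of a diagram: the laps joined by its chords, with their signs, by increasing angle. A code
    determines the diagram up to equivalence, because the straight-line homotopy between two
    families of lifts with the same code preserves their order. A code whose chords join distinct
    laps is realized by a word, because virtual letters permute the strands without creating chords.
    A rotation then brings any chord or any cut point to the place where relation (2) or (3) acts.
    The lifts of the two endpoints of a chord share their fractional part, so sliding to integer
    points moves both by the same amount and keeps the arcs integral throughout the homotopy. The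
    reduction is carried out for membership in an arbitrary subgroup [H]: surjectivity takes the
    image of [u], finite generation the span of a finite list. *)

Lemma circ_continuous : continuous (@circ R).
Proof.
move=> t; apply/cvgrPdist_lt => e e0.
have [r r0 ->] : exists2 r : R, 0 < r & e = (r%:C)%C.
  move: e0; case: e => a b; rewrite [in X in X -> _]ltcE /= => /andP[/eqP b0 a0].
  by exists a; rewrite ?b0.
have r2 : 0 < r / 2 by rewrite divr_gt0.
have cc : (fun u => cos (2 * pi * u)) @ t --> cos (2 * pi * t).
  apply: continuous_comp; last exact: continuous_cos.
  by apply: cvgM; [exact: cvg_cst|exact: cvg_id].
have cs : (fun u => sin (2 * pi * u)) @ t --> sin (2 * pi * t).
  apply: continuous_comp; last exact: continuous_sin.
  by apply: cvgM; [exact: cvg_cst|exact: cvg_id].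
move/cvgrPdist_lt : cc => /(_ _ r2) cc; move/cvgrPdist_lt : cs => /(_ _ r2) cs.
near=> u.
have c1 : `|cos (2 * pi * t) - cos (2 * pi * u)| < r / 2 by near: u.
have s1 : `|sin (2 * pi * t) - sin (2 * pi * u)| < r / 2 by near: u.
have -> : circ t - circ u = ((cos (2 * pi * t) - cos (2 * pi * u))%:C
    + 'i * (sin (2 * pi * t) - sin (2 * pi * u))%:C)%C :> complex R.
  by rewrite /circ /=; simpc.
apply: (le_lt_trans (ler_normD _ _)).
rewrite normrM !normc_def /= !expr0n /= !expr1n ?addr0 ?add0r sqrtr1 mul1r.
rewrite !sqrtr_sqr -rmorphD /= ltcR; lra.
Unshelve. all: by end_near. Qed.

Lemma circ_int (k : int) : circ (k%:~R : R) = 1.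
Proof.
case: k => k; first exact: circ_nat.
have := circ_nat R k.+1; rewrite NegzE => e.
have := circD (k.+1%:R : R) (- k.+1%:R); rewrite subrr circ0 e mul1r => ->.
by rewrite rmorphN.
Qed.

Lemma circDint t (k : int) : circ (t + k%:~R) = circ t.
Proof. by rewrite circD circ_int mulr1. Qed.

Lemma circ_shift c t : exists k : int, c <= t + k%:~R < c + 1.
Proof.
exists (- Num.floor (t - c)); have := floor_itv (t - c).
rewrite rmorphN rmorphD /= => /andP[? ?]; lra.
Qed.

Lemma circ_eq s t : circ s = circ t -> exists k : int, t = s + k%:~R.
Proof.
have [i /[dup] si] := circ_shift 0 s; have [j /[dup] tj] := circ_shift 0 t.
rewrite !add0r => tj1 si1 e; exists (i - j).
have := @circ_inj R (s + i%:~R) (t + j%:~R) si1 tj1.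
by rewrite !circDint => /(_ e); rewrite rmorphB /= => ?; lra.
Qed.

Lemma circ_inj_window c s t :
  c <= s < c + 1 -> c <= t < c + 1 -> circ s = circ t -> s = t.
Proof.
move=> sc tc; have e u : circ u = circ (u - c) * circ c by rewrite -circD addrNK.
have c0 : circ c != 0.
  by apply/eqP => c0; have := circ_S1 c; rewrite /S1 /= c0 normr0 => /esym/eqP; rewrite oner_eq0.
by rewrite (e s) (e t) => /(mulIf c0) /circ_inj i; apply: (subIr c); apply: i; lra.
Qed.

Lemma circ_onto_S1 c z : S1 z -> exists2 t, c <= t < c + 1 & circ t = z.
Proof.
suff tz : S1 z -> exists t, circ t = z.
  move=> /tz[t <-]; have [k kc] := circ_shift c t.
  by exists (t + k%:~R) => //; rewrite circDint.
case: z => x y; rewrite /S1 /= normc_def /= => -[] xy.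
have {}xy : x ^+ 2 + y ^+ 2 = 1.
  by have := sqr_sqrtr (addr_ge0 (sqr_ge0 x) (sqr_ge0 y)); rewrite xy expr1n.
have x1 : -1 <= x <= 1.
  have := sqr_ge0 y; move: xy; rewrite !expr2 => ? ?; nra.
have pi1 : pi != 0 :> R by rewrite gt_eqF // pi_gt0.
have e2 (a : R) : 2 * pi * (a / (2 * pi)) = a by rewrite mulrC divfK // mulf_neq0 ?pnatr_eq0.
have sx : sin (acos x) = `|y|.
  by rewrite sin_acos // -xy addrC addKr sqrtr_sqr.
have [y0|y0] := leP 0 y.
  by exists (acos x / (2 * pi)); rewrite /circ e2 acosK // sx ger0_norm.
exists (- acos x / (2 * pi)).
by rewrite /circ e2 cosN sinN acosK // sx ltr0_norm // opprK.
Qed.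

Lemma S1_circ c : @S1 R = @circ R @` `[c, c + 1].
Proof.
rewrite eqEsubset; split=> [z /(circ_onto_S1 c)[t tc <-]|_ [t _ <-]].
  by exists t => //; rewrite /= in_itv /=; case/andP: tc => -> /ltW ->.
exact: circ_S1.
Qed.

Lemma compact_S1 : compact (@S1 R).
Proof.
rewrite (S1_circ 0); apply: continuous_compact; last exact: segment_compact.
exact/continuous_subspaceT/circ_continuous.
Qed.

End CircleTopology.

(** On the compact [K], [p] is a closed map: the image of a closed subset is compact, hence closed
    in a Hausdorff target. Continuity of [g] can therefore be tested after composition with [p]. *)
Lemma factor_continuous (T U V : topologicalType) (K : set T) (p : T -> U)
    (g : U -> V) :
  hausdorff_space U -> compact K -> {within K, continuous p} ->
  {within K, continuous (g \o p)} -> {within p @` K, continuous g}.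
Proof.
move=> hU cK cp /continuous_closedP cgp; apply/continuous_closedP => C cC.
have /closed_subspaceP[W cW WK] := cgp _ cC.
apply/closed_subspaceP; exists (p @` (W `&` K)).
  apply: compact_closed => //; apply: continuous_compact.
    by apply: continuous_subspaceW cp => x [].
  by rewrite setIC; apply: compact_closedI.
rewrite WK eqEsubset; split=> [_ [[x [gx Kx] <-] _]|y [gpx [x Kx e]]].
  by split=> //; exists x.
by rewrite -e in gpx *; split; exists x.
Qed.

Lemma hausdorff_Cplx (R : realType) : hausdorff_space (Cplx R).
Proof. exact: norm_hausdorff. Qed.

(** Compactness makes the inverse continuous: [factor_continuous] applies to [p := f], since
    [g \o f] is the identity on the circle. *)
Lemma homeo_on_S1 (R : realType) (f g : Cplx R -> Cplx R) :
  {within @S1 R, continuous f} -> (forall x, S1 x -> S1 (f x) /\ g (f x) = x) ->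
  (forall x, S1 x -> S1 (g x) /\ f (g x) = x) -> homeo_on (@S1 R) f.
Proof.
move=> cf fK gK; exists g; split; [exact: cf| |exact: fK|exact: gK].
have fS : f @` @S1 R = @S1 R.
  rewrite eqEsubset; split=> [_ [x /fK[fx _] <-]//|x /gK[gx e]].
  by exists (g x).
suff : {within f @` @S1 R, continuous g} by rewrite fS.
apply: factor_continuous.
- exact: hausdorff_Cplx.
- exact: compact_S1.
- exact: cf.
- have ci : {within @S1 R, continuous (@id (Cplx R))}.
    by apply: continuous_subspaceT => x; exact: cvg_id.
  apply: subspace_eq_continuous ci => x; rewrite inE => /fK[_ e].
  by rewrite /from_subspace /= e.
Qed.

(* Prolonging linearly on the left of the first knot keeps the interpolating
   function globally increasing, so each step of the induction is a composite. *)
Lemma increasing_interpolation (R : realType) (l : seq (R * R)) :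
  sorted (fun p q => (p.1 < q.1) && (p.2 < q.2)) l ->
  exists F : R -> R, [/\ continuous F, {homo F : x y / x < y}
    & forall p, p \in l -> F p.1 = p.2].
Proof.
elim: l => [|[a a'] [|[b b'] l] IH].
- by exists id; split=> // x; exact: cvg_id.
- move=> _; exists (fun x => x - a + a'); split=> [x|x y xy|p].
  + by apply: cvgD; [apply: cvgB; [exact: cvg_id|exact: cvg_cst]|exact: cvg_cst].
  + by lra.
  + by rewrite inE => /eqP -> /=; ring.
rewrite [sorted _ _]/= => /andP[/andP[/= ab ab'] sl]; have [G [cG iG Gl]] := IH sl.
have Gb : G b = b' by apply: (Gl (b, b')); rewrite inE eqxx.
have nG : {homo G : x y / x <= y} by exact: ltW_homo.
pose k := (b' - a') / (b - a).
have k0 : 0 < k by rewrite divr_gt0 // subr_gt0.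
exists (fun x => G (Num.max x b) + (Num.min x b - b) * k); split.
- move=> x; apply: cvgD.
    apply: (continuous_comp (f := fun x => Num.max x b)); last exact: cG.
    by apply: continuous_max; [exact: cvg_id|exact: cvg_cst].
  apply: cvgM; last exact: cvg_cst.
  apply: cvgB; last exact: cvg_cst.
  by apply: continuous_min; [exact: cvg_id|exact: cvg_cst].
- move=> x y xy; have [yb|yb] := leP y b.
    rewrite max_r; last lra; rewrite min_l; last lra.
    by rewrite ltrD2l ltr_pM2r //; lra.
  have GG : G (Num.max x b) <= G y by apply: nG; rewrite ge_max; lra.
  rewrite subrr mul0r addr0; have [xb|xb] := leP x b.
    by rewrite max_r // in GG; have : G b < G y by [exact: iG]; rewrite Gb; nra.
  by rewrite subrr mul0r addr0; exact: iG.
- move=> [y y']; rewrite inE => /orP[/eqP[-> ->]|yl] /=.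
    rewrite max_r ?min_l ?ltW // Gb /k; field; lra.
  have by_ : b <= y.
    move: yl; rewrite inE => /orP[/eqP[-> _]//|yl].
    have tr : transitive (fun p q : R * R => (p.1 < q.1) && (p.2 < q.2)).
      by move=> p q r /andP[? ?] /andP[? ?]; apply/andP; split; lra.
    by have /allP/(_ _ yl)/andP[/ltW] := order_path_min tr sl.
  by rewrite max_l // min_r // (Gl (y, y') yl) subrr mul0r addr0.
Qed.

(* The lift of the homotopy is [(1 - s) id + s F], with [F] an increasing
   interpolation of [x |-> x'] that commutes with the unit translation at the
   ends of a fundamental interval. *)
Lemma circle_homotopy (R : realType) (I : finType) (x x' : I -> R) :
  (forall i j, x i < x j + 1) -> (forall i j, x' i < x' j + 1) ->
  (forall i j, x i < x j -> x' i < x' j) ->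
  (forall i j, x i = x j -> x' i = x' j) ->
  exists h : Cplx R -> R -> Cplx R,
    [/\ {within @S1 R `*` `[0, 1]%classic, continuous (fun p => h p.1 p.2)},
        (forall z, S1 z -> h z 0 = z),
        (forall t, 0 <= t <= 1 -> homeo_on (@S1 R) (h^~ t))
      & forall i t, h (circ (x i)) t = circ (x i + t * (x' i - x i))].
Proof.
move=> xc xc' lt_xx' eq_xx'.
have [F [a [cF iF Fa Fx xa]]] : exists (F : R -> R) (a : R),
    [/\ continuous F, {homo F : y z / y < z}, F (a + 1) = F a + 1, (forall i, F (x i) = x' i)
    & forall i, a <= x i < a + 1].
  case: (pickP (@predT I)) => [j0 _|I0]; last first.
    exists id, 0; split=> // [y|i|i]; first exact: cvg_id.
      by have := I0 i.
    by have := I0 i.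
  pose i0 := [arg min_(i < j0) x i]%O.
  have i0P i : x i0 <= x i by rewrite /i0; case: arg_minP => // k _; apply.
  have i0P' i : x' i0 <= x' i.
    by have := i0P i; rewrite le_eqVlt => /predU1P[/eq_xx' ->//|/lt_xx'/ltW].
  pose l := sort (fun p q : R * R => p.1 <= q.1) (undup [seq (x i, x' i) | i <- enum I]).
  have lP p : p \in l -> exists i, p = (x i, x' i).
    by rewrite mem_sort mem_undup => /mapP[i _ ->]; exists i.
  have li i : (x i, x' i) \in l.
    by rewrite mem_sort mem_undup map_f // mem_enum.
  (* The extra knot, one unit after the smallest point, is what gives [F (a + 1) = F a + 1]. It lies
     to the right of the others because all points are within one unit of each other. *)
  have sl : sorted (fun p q : R * R => (p.1 < q.1) && (p.2 < q.2))
      (rcons l (x i0 + 1, x' i0 + 1)).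
    apply: pairwise_sorted; rewrite pairwise_rcons; apply/andP; split.
      apply/allP => p /lP[i ->] /=.
      by have := xc i i0; have := xc' i i0; have := i0P i; have := i0P' i; lra.
    have /sort_sorted sle : total (fun p q : R * R => p.1 <= q.1).
      by move=> p q; exact: le_total.
    have letr : transitive (fun p q : R * R => p.1 <= q.1).
      by move=> p q r; exact: le_trans.
    have := sle (undup [seq (x i, x' i) | i <- enum I]); rewrite -/l.
    rewrite (sorted_pairwise letr) => pl.
    have ul : pairwise (fun p q => p != q) l.
      by rewrite -uniq_pairwise sort_uniq undup_uniq.
    have := conj pl ul; move/andP; rewrite -pairwise_relI.
    apply: (@sub_in_pairwise _ (mem l)); last exact/allP.
    move=> p q /lP[i ->] /lP[j ->] /= /andP[xij nij].
    have xlt : x i < x j.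
      rewrite lt_neqAle xij andbT; apply: contra_neq nij => e.
      by rewrite e (eq_xx' _ _ e).
    by rewrite xlt lt_xx'.
  have [F [cF iF Fl]] := increasing_interpolation sl.
  have Fx i : F (x i) = x' i by apply: (Fl (x i, x' i)); rewrite mem_rcons inE li orbT.
  exists F, (x i0); split=> //.
    by rewrite Fx; apply: (Fl (x i0 + 1, x' i0 + 1)); rewrite mem_rcons inE eqxx.
  by move=> i; rewrite i0P xc.
pose y z := xget a [set t | a <= t < a + 1 /\ circ t = z].
have yP z : S1 z -> a <= y z < a + 1 /\ circ (y z) = z.
  move=> /(circ_onto_S1 a)[t ta tz].
  have := @xgetPex _ a [set t | a <= t < a + 1 /\ circ t = z]; apply.
  by exists t.
pose g z := F (y z) - y z.
have gE t : a <= t <= a + 1 -> g (circ t) = F t - t.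
  move=> /andP[a_t]; rewrite le_eqVlt => /predU1P[->|ta].
    have [ya yE] := yP _ (circ_S1 (a + 1)).
    rewrite /g; have -> : y (circ (a + 1)) = a.
      apply: (circ_inj_window ya); first by rewrite lexx ltrDl ltr01.
      by rewrite yE -(circDint a 1).
    by rewrite Fa; ring.
  have [ya yE] := yP _ (circ_S1 t).
  by rewrite /g (circ_inj_window ya _ yE) // a_t.
have cg : {within @S1 R, continuous g}.
  rewrite (S1_circ a); apply: factor_continuous.
  - exact: hausdorff_Cplx.
  - exact: segment_compact.
  - exact/continuous_subspaceT/circ_continuous.
  - have cG : {within `[a, a + 1], continuous (fun t => F t - t)}.
      apply: continuous_subspaceT => t; apply: cvgB; [exact: cF|exact: cvg_id].
    apply: subspace_eq_continuous cG => t; rewrite inE /= in_itv /= => ta.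
    by rewrite /from_subspace /= gE.
exists (fun z t => z * circ (t * g z)); split.
- move=> p; apply: cvgM.
    have cid : {within @S1 R `*` `[0, 1]%classic, continuous (@fst (Cplx R) R)}.
      by apply: continuous_subspaceT => q; exact: cvg_fst.
    exact: cid.
  apply: (@cvg_comp _ _ _ (fun q : Cplx R * R => q.2 * g q.1)
    (@circ R) _ (nbhs (p.2 * g p.1))); last exact: circ_continuous.
  have cg1 : {within @S1 R `*` `[0, 1]%classic,
      continuous (fun q : Cplx R * R => g q.1)} by exact: within_continuous_fst.
  apply: cvgM; last exact: cg1.
  have csnd : {within @S1 R `*` `[0, 1]%classic, continuous (@snd (Cplx R) R)}.
    by apply: continuous_subspaceT => q; exact: cvg_snd.
  exact: csnd.
- by move=> z _; rewrite mul0r circ0 mulr1.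
- move=> t /andP[t0 t1].
  pose G u := u + t * (F u - u).
  have hE u : a <= u <= a + 1 -> circ u * circ (t * g (circ u)) = circ (G u).
    by move=> ua; rewrite gE // -circD.
  have hS z : S1 z -> S1 (z * circ (t * g z)).
    move=> /(circ_onto_S1 a)[u /andP[ua1 /ltW ua2] <-].
    by rewrite hE ?ua1 //; exact: circ_S1.
  have iG u v : u < v -> G u < G v.
    move=> uv; rewrite /G; have := iF _ _ uv; move: (F u) (F v) => fu fv fuv.
    have -> : v + t * (fv - v) = u + t * (fu - u) + ((1 - t) * (v - u) + t * (fv - fu)) by ring.
    rewrite ltrDl; have [->|tn0] := eqVneq t 0.
      by rewrite subr0 mul1r mul0r addr0 subr_gt0.
    by rewrite ltr_wpDl ?mulr_ge0 ?mulr_gt0 ?subr_ge0 ?subr_gt0 ?lt0r ?tn0 // ltW.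
  have cG : continuous G.
    move=> u; apply: cvgD; first exact: cvg_id.
    apply: cvgM; first exact: cvg_cst.
    by apply: cvgB; [exact: cF|exact: cvg_id].
  have Ga : G (a + 1) = G a + 1 by rewrite /G Fa; ring.
  (* Preimages come from the intermediate value theorem on a fundamental interval; the continuity of
     the inverse they define is left to compactness. *)
  have sur z : S1 z -> exists w, S1 w /\ w * circ (t * g w) = z.
    move=> /(circ_onto_S1 (G a))[v va <-].
    have [|||u] := @IVT R G a (a + 1) v.
    - by rewrite lerDl ler01.
    - exact: continuous_subspaceT.
    - by rewrite Ga min_l ?max_r ?lerDl ?ler01 //; case/andP: va => -> /ltW.
    rewrite in_itv /= => ua <-; exists (circ u); split; first exact: circ_S1.
    exact: hE.
  have wS1 u : a <= u < a + 1 -> a <= u <= a + 1 by case/andP => -> /ltW ->.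
  have inj w1 w2 : S1 w1 -> S1 w2 ->
      w1 * circ (t * g w1) = w2 * circ (t * g w2) -> w1 = w2.
    move=> /(circ_onto_S1 a)[u1 ua1 <-] /(circ_onto_S1 a)[u2 ua2 <-].
    rewrite !hE ?wS1 // => e.
    have GE u : a <= u < a + 1 -> G a <= G u < G a + 1.
      move=> /andP[]; rewrite le_eqVlt -Ga => /predU1P[->|/iG/ltW ->] /iG -> //.
      by rewrite lexx.
    have {}e := circ_inj_window (GE _ ua1) (GE _ ua2) e.
    congr circ; apply/eqP; apply: contra_eqT e => u12.
    by have := u12; rewrite neq_lt => /orP[]/iG; [move/lt_eqF ->|move/gt_eqF ->].
  pose k z := xget (1 : Cplx R) [set w | S1 w /\ w * circ (t * g w) = z].
  have kP z : S1 z -> S1 (k z) /\ k z * circ (t * g (k z)) = z.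
    move=> /sur[w w_]; rewrite /k.
    have := @xgetPex _ 1 [set w | S1 w /\ w * circ (t * g w) = z]; apply.
    by exists w.
  apply: (@homeo_on_S1 _ _ k).
  + move=> z; apply: cvgM.
      have cid : {within @S1 R, continuous (@id (Cplx R))}.
        by apply: continuous_subspaceT => q; exact: cvg_id.
      exact: cid.
    apply: (@cvg_comp _ _ _ g (fun u => circ (t * u)) _ (nbhs (g z))).
      exact: cg.
    apply: continuous_comp; last exact: circ_continuous.
    by apply: cvgM; [exact: cvg_cst|exact: cvg_id].
  + move=> z Sz; split; first exact: hS.
    have [Sk e] := kP _ (hS z Sz); exact: inj.
  + by [].
- move=> i t; rewrite gE ?Fx -?circD //.
  by case/andP: (xa i) => -> /ltW ->.
Qed.

(** * Braided Gauss diagrams by coordinates *)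

(* The circle is seen as [R / m Z]: a chord diagram is given by lifts [x] of
   its endpoints, [(i, true)] being the tail of chord [i] and [(i, false)] its
   head. *)
Definition cpt (R : realType) (m : nat) (x : R) : Cplx R := circ (x / m%:R).

Definition rep (R : realType) (m : nat) (I : finType) (x : I * bool -> R)
    (s : I -> bool) (D : gauss_diagram R) : Prop :=
  let ch i := (cpt m (x (i, true)), cpt m (x (i, false))) in
  [/\ braid_index D = m, injective (cpt m \o x),
      (forall i, ch i \in chords (diagram D)),
      (forall c, c \in chords (diagram D) -> exists i, c = ch i)
    & (forall i, sign D (ch i) = s i)].

Section Representations.
Variable R : realType.
Implicit Types (D : gauss_diagram R) (m : nat) (I J : finType).

Lemma rep_index_gt0 m I x s D : @rep R m I x s D -> (0 < m)%N.
Proof. by case=> <- _ _ _ _; exact: index_gt0. Qed.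

Lemma cpt_add m x (k : int) : (0 < m)%N ->
  cpt m (x + m%:R * k%:~R) = cpt m x :> Cplx R.
Proof.
move=> m0; rewrite /cpt -[RHS](circDint _ k); congr circ.
by field; rewrite pnatr_eq0 -lt0n.
Qed.

Lemma cptX m (x : R) : (0 < m)%N -> cpt m x ^+ m = circ x.
Proof.
by move=> m0; rewrite /cpt circX mulrC divfK // pnatr_eq0 -lt0n.
Qed.

Lemma cpt_eq m (x y : R) : (0 < m)%N -> cpt m x = cpt m y ->
  exists k : int, y = x + m%:R * k%:~R.
Proof.
move=> m0 /circ_eq[k e]; exists k.
have m1 : m%:R != 0 :> R by rewrite pnatr_eq0 -lt0n.
by rewrite -[LHS](divfK m1) e mulrDl divfK // mulrC.
Qed.

Lemma cpt_inj m (c x y : R) : c <= x < c + m%:R -> c <= y < c + m%:R ->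
  cpt m x = cpt m y -> x = y.
Proof.
move=> xc yc; have m0 : 0 < m%:R :> R by lra.
have w z : c <= z < c + m%:R -> c / m%:R <= z / m%:R < c / m%:R + 1.
  move=> /andP[? ?]; rewrite ler_pM2r ?invr_gt0 //.
  by rewrite ltr_pdivrMr // mulrDl divfK ?lt0r_neq0 // mul1r; apply/andP.
move=> /(circ_inj_window (w _ xc) (w _ yc)).
by apply: mulIf; rewrite invr_eq0 lt0r_neq0.
Qed.

Lemma cpt_window m (c x : R) : (0 < m)%N ->
  exists2 y, c <= y < c + m%:R & exists k : int, y = x + m%:R * k%:~R.
Proof.
rewrite -(ltr0n R) => m0; have [k kc] := circ_shift (c / m%:R) (x / m%:R).
exists (x + m%:R * k%:~R); last by exists k.
have -> : x + m%:R * k%:~R = (x / m%:R + k%:~R) * m%:R :> R.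
  by field; rewrite lt0r_neq0.
have -> : c + m%:R = (c / m%:R + 1) * m%:R :> R.
  by rewrite mulrDl mul1r divfK ?lt0r_neq0.
by rewrite -ler_pdivrMr // ltr_pM2r.
Qed.

Lemma rep_card m I x s D : @rep R m I x s D -> #|` chords (diagram D)| = #|I|.
Proof.
case=> _ ix xD Dx _; rewrite cardE.
rewrite -(size_map (fun i => (cpt m (x (i, true)), cpt m (x (i, false)))) (enum I)).
apply/perm_size/uniq_perm; first exact: fset_uniq.
- rewrite map_inj_in_uniq ?enum_uniq // => i j _ _ /(congr1 fst) e.
  by have [] := @ix (i, true) (j, true) e.
- move=> c; apply/idP/mapP => [/Dx[i ->]|[i _ ->]]; last exact: xD.
  by exists i; rewrite ?mem_enum.
Qed.

Lemma rep_int m I x s D i : @rep R m I x s D ->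
  exists k : int, x (i, false) = x (i, true) + k%:~R.
Proof.
move=> rD; have m0 := rep_index_gt0 rD; case: rD => eI _ /(_ i) xD _ _.
by have := chords_pow xD; rewrite /= eI !cptX // => /circ_eq.
Qed.

Lemma rep_congr m I (x y : I * bool -> R) s t D :
  (forall p, cpt m (x p) = cpt m (y p)) -> s =1 t -> rep m x s D -> rep m y t D.
Proof.
move=> xy st [eI ix xD Dx sD]; split=> //.
- by move=> p q; rewrite /= -!xy; exact: ix.
- by move=> i; rewrite -!xy.
- by move=> c /Dx[i ->]; exists i; rewrite !xy.
- by move=> i; rewrite -!xy -st.
Qed.

Lemma rep_exists m I (x : I * bool -> R) s : (0 < m)%N ->
  injective (cpt m \o x) ->
  (forall i, exists k : int, x (i, false) = x (i, true) + k%:~R) ->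
  exists D, rep m x s D.
Proof.
move=> m0 ix xk.
pose ch i := (cpt m (x (i, true)), cpt m (x (i, false))).
have chi : injective ch by move=> i j /(congr1 fst) e; have [] := @ix (i, true) (j, true) e.
pose C := [fset c in [seq ch i | i <- enum I]]%fset.
have CP c : reflect (exists i, c = ch i) (c \in C).
  rewrite in_fset; apply: (iffP mapP) => [[i _ ->]|[i ->]]; exists i => //.
  by rewrite mem_enum.
have Cw c : c \in C -> [/\ S1 c.1, S1 c.2 & c.1 <> c.2].
  by move=> /CP[i ->]; split; [exact: circ_S1|exact: circ_S1|move/ix].
have Cd c d z : c \in C -> d \in C -> z \in ends c -> z \in ends d -> c = d.
  move=> /CP[i ->] /CP[j ->]; rewrite !inE /=.
  by move=> /orP[]/eqP-> /orP[]/eqP/ix[] => [->|->|->|->].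
have Cp c : c \in chords (ChordDiagram Cw Cd) -> c.1 ^+ m = c.2 ^+ m.
  by move=> /CP[i ->]; rewrite /= !cptX //; have [k ->] := xk i; rewrite circDint.
pose sg c := [exists i, (c == ch i) && s i].
exists (GaussDiagram sg m0 Cp); split=> //= [i|c /CP//|i].
  by apply/CP; exists i.
apply/existsP/idP => [[j /andP[/eqP/chi ->]]//|si].
by exists i; rewrite eqxx.
Qed.

Lemma rep_reindex m I J (f : J -> I) (x : I * bool -> R) s D : bijective f ->
  rep m x s D -> rep m (fun p => x (f p.1, p.2)) (s \o f) D.
Proof.
move=> [g fK gK] [eI ix xD Dx sD]; split=> //.
- move=> [i b] [j b'] /= /ix[/(can_inj fK) -> -> //].
- by move=> c /Dx[i ->]; exists (g i) => /=; rewrite gK.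
Qed.

Lemma rep_total D : exists (I : finType) (x : I * bool -> R) s,
  rep (braid_index D) x s D /\ forall p, 0 <= x p < (braid_index D)%:R.
Proof.
set m := braid_index D; have m0 : (0 < m)%N := index_gt0 D.
have m0' : 0 < m%:R :> R by rewrite ltr0n.
have lift z : S1 z -> exists2 y : R, 0 <= y < m%:R & cpt m y = z.
  move=> /(circ_onto_S1 0)[t tc <-]; exists (t * m%:R); last first.
    by rewrite /cpt mulfK // lt0r_neq0.
  by move: tc; rewrite add0r => /andP[t0 t1]; rewrite mulr_ge0 ?gtr_pMl // ltW.
pose I : finType := chords (diagram D).
pose ep (p : I * bool) := if p.2 then (val p.1).1 else (val p.1).2.
have epS p : S1 (ep p).
  by case: p => i [] /=; have [] := chords_wf (valP i).
pose x p := xget 0 [set y : R | 0 <= y < m%:R /\ cpt m y = ep p].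
have xP p : 0 <= x p < m%:R /\ cpt m (x p) = ep p.
  have [y y1 y2] := lift _ (epS p).
  have := @xgetPex _ 0 [set y : R | 0 <= y < m%:R /\ cpt m y = ep p]; apply.
  by exists y.
exists I, x, (fun i => sign D (val i)); split=> [|p]; last by case: (xP p).
have chE i : (cpt m (x (i, true)), cpt m (x (i, false))) = val i.
  by rewrite (xP _).2 (xP (i, false)).2 /ep /= -surjective_pairing.
split=> //.
- move=> [i b] [j c] /=; rewrite (xP _).2 (xP (j, c)).2 => e.
  have ij : i = j.
    apply/val_inj; apply: (chords_disj (valP i) (valP j) (x := ep (i, b))).
      by rewrite /ep !inE; case: b {e}; rewrite eqxx ?orbT.
    by rewrite e /ep !inE; case: c {e}; rewrite eqxx ?orbT.
  rewrite ij in e *; congr (_, _); have [_ _ ne] := chords_wf (valP j).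
  by case: b c e => [] [] //= e; case: ne.
- by move=> i; rewrite chE; exact: valP.
- by move=> c cD; exists [` cD]%fset; rewrite chE.
- by move=> i; rewrite chE.
Qed.

(** The lifts move along straight lines. The two endpoints of a chord are displaced equally, so
    their difference remains the same integer at every time, as equivalence demands. *)
Lemma rep_equiv m I (x x' : I * bool -> R) s D D' :
  rep m x s D -> rep m x' s D' ->
  (forall p q, x p < x q + m%:R) -> (forall p q, x' p < x' q + m%:R) ->
  (forall p q, x p < x q -> x' p < x' q) ->
  (forall i, x' (i, false) - x' (i, true) = x (i, false) - x (i, true)) ->
  gd_equiv D D'.
Proof.
move=> rD rD' xc xc' xx' dx; have m0 := rep_index_gt0 rD.
have m0' : 0 < m%:R :> R by rewrite ltr0n.
have w (y : I * bool -> R) : (forall p q, y p < y q + m%:R) ->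
    forall p q, y p / m%:R < y q / m%:R + 1.
  by move=> yc p q; rewrite ltr_pdivrMr // mulrDl mul1r divfK ?lt0r_neq0.
have [eI ix xD Dx sD] := rD; have [eI' ix' xD' Dx' sD'] := rD'.
have [h [ch h0 hh hx]] : exists h : Cplx R -> R -> Cplx R,
    [/\ {within @S1 R `*` `[0, 1]%classic, continuous (fun p => h p.1 p.2)},
        (forall z, S1 z -> h z 0 = z),
        (forall t, 0 <= t <= 1 -> homeo_on (@S1 R) (h^~ t))
      & forall p t, h (cpt m (x p)) t = cpt m (x p + t * (x' p - x p))].
  have [||h [? ? ? hx]] := @circle_homotopy R _ (fun p => x p / m%:R)
    (fun p => x' p / m%:R) (w _ xc) (w _ xc').
  - by move=> p q; rewrite !ltr_pM2r ?invr_gt0 //; exact: xx'.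
  - move=> p q /(mulIf _) e; have -> // : p = q.
    by apply: ix; rewrite /= e // invr_eq0 lt0r_neq0.
  - exists h; split=> // p t; rewrite /cpt hx; congr circ; ring.
have hx1 p : h (cpt m (x p)) 1 = cpt m (x' p) by rewrite hx mul1r addrC subrK.
split; first by rewrite eI eI'.
exists h; split=> //.
- move=> d t /Dx[i ->] _ /=; rewrite eI !hx !cptX //.
  have [k e] := rep_int i rD; rewrite -[RHS](circDint _ (- k)); congr circ.
  have := dx i; rewrite e rmorphN /= => {}e; have -> : x' (i, false) = x' (i, true) + k%:~R by lra.
  by ring.
- split=> [|d /Dx[i ->] /=]; last by rewrite !hx1 sD sD'.
  apply/fsetP => d; apply/idP/imfsetP => [/Dx'[i ->]|[_ /Dx[i ->] ->] /=].
    by eexists; [exact: xD i|rewrite /= !hx1].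
  by rewrite !hx1; exact: xD'.
Qed.

(** The lifts may spread over more than one turn, so they are first brought into [[0, m[]; the
    translation by [a] then preserves order and differences. *)
Lemma rep_rotate m I (x : I * bool -> R) s a D D' :
  rep m x s D -> rep m (fun p => x p + a) s D' -> gd_equiv D D'.
Proof.
move=> rD rD'; have m0 := rep_index_gt0 rD.
have /boolp.choice[y yP] p : exists y, 0 <= y < 0 + m%:R /\
    exists k : int, y = x p + m%:R * k%:~R.
  by have [y ? ?] := cpt_window 0 (x p) m0; exists y.
have xy p : cpt m (x p) = cpt m (y p).
  by have [_ [k ->]] := yP p; rewrite cpt_add.
have xya p : cpt m (x p + a) = cpt m (y p + a).
  by have [_ [k ->]] := yP p; rewrite -addrA [_ * _ + a]addrC addrA cpt_add.
have ry := rep_congr xy (fun=> erefl) rD.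
have ry' := rep_congr xya (fun=> erefl) rD'.
apply: (rep_equiv ry ry') => [p q|p q|p q|i].
- by have [? _] := yP p; have [? _] := yP q; lra.
- by have [? _] := yP p; have [? _] := yP q; lra.
- by rewrite ltrD2r.
- by ring.
Qed.

(** The two diagrams need not be equal: the values of [sign] off the chords are unconstrained. *)
Lemma rep_unique m I (x : I * bool -> R) s D D' :
  rep m x s D -> rep m x s D' -> gd_equiv D D'.
Proof.
move=> rD rD'; apply: (rep_rotate (a := 0) rD).
by apply: rep_congr rD' => // p; rewrite addr0.
Qed.

End Representations.

(** * Codes of diagrams and of words *)

(* A chord over the angle [theta] joins laps [a] and [b] of the circle of
   length [m], i.e. its endpoints are [a + theta] and [b + theta]; the code of
   a diagram lists the triples (a, b, sign) of its chords by increasing angle,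
   chords over the same angle coming in any order. *)
Definition code := seq (nat * nat * bool).

Definition code_lap (e : code) (p : 'I_(size e) * bool) : nat :=
  let t := nth (0%N, 0%N, true) e p.1 in if p.2 then t.1.1 else t.1.2.

Definition code_sign (e : code) (i : 'I_(size e)) : bool :=
  (nth (0%N, 0%N, true) e i).2.

Definition code_in (m : nat) (e : code) : bool :=
  all (fun t => (t.1.1 < m)%N && (t.1.2 < m)%N) e.

(** The angles only have to lie within less than one unit of each other, not in [[0, 1[]: the sign
    reversal uses angles in []0, 1]]. *)
Definition has_code (R : realType) (m : nat) (e : code) (D : gauss_diagram R) :=
  exists theta : 'I_(size e) -> R,
    [/\ (forall i j : 'I_(size e), (i <= j)%N -> theta i <= theta j),
        (forall i j, theta i < theta j + 1)
      & rep m (fun p => (code_lap p)%:R + theta p.1) (@code_sign e) D].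

Lemma has_code_card (R : realType) m e (D : gauss_diagram R) :
  has_code m e D -> #|` chords (diagram D)| = size e.
Proof. by move=> [t [_ _ /rep_card ->]]; rewrite card_ord. Qed.

Lemma code_inP m e (p : 'I_(size e) * bool) : code_in m e -> (code_lap p < m)%N.
Proof.
move=> /allP/(_ _ (mem_nth (0%N, 0%N, true) (ltn_ord p.1)))/andP[? ?].
by rewrite /code_lap; case: ifP.
Qed.

(** The code determines the order of the lifts: by lap first, then, within a lap, by rank of the
    chord. Distinct endpoints in the same lap cannot have equal angles, by injectivity. *)
Lemma has_code_equiv (R : realType) m e (D D' : gauss_diagram R) :
  code_in m e -> has_code m e D -> has_code m e D' -> gd_equiv D D'.
Proof.
move=> em [t [tt tc rD]] [t' [tt' tc' rD']].
have win (th : 'I_(size e) -> R) : (forall i j, th i < th j + 1) ->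
    forall p q, (code_lap p)%:R + th p.1 < (code_lap q)%:R + th q.1 + m%:R.
  move=> thc p q; have := thc p.1 q.1; have := code_inP p em.
  rewrite -(ler_nat R) -natr1 => ?.
  by have : 0 <= (code_lap q)%:R :> R by [exact: ler0n]; lra.
apply: (rep_equiv rD rD') => [||p q|i]; last by ring.
- exact: win.
- exact: win.
- have := tc q.1 p.1; have := tc' p.1 q.1.
  case: (ltngtP (code_lap p) (code_lap q)) => [||pq].
  + by rewrite -(ler_nat R) -natr1; lra.
  + by rewrite -(ler_nat R) -natr1; lra.
  move=> _ _; rewrite pq !ltrD2l => tpq.
  have pq1 : (p.1 <= q.1)%N by rewrite leqNgt; apply/negP => /ltnW/tt; lra.
  rewrite lt_neqAle tt' // andbT; apply: contraTneq tpq => e'.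
  have [_ /(_ p q) ip _ _ _] := rD'.
  by rewrite (ip _) ?ltxx //= pq e'.
Qed.

(* Tail position, head position and sign of the chord of a crossing. *)
Definition letter_ends (l : letter) : option (nat * nat * bool) :=
  match l with
  | Crossing i true => Some (i, i.+1, true)
  | Crossing i false => Some (i.+1, i, false)
  | Virtual _ => None
  end.

(** The rank of a position in [P] is the number of the lap passing there. *)
Definition place (P : seq nat) (t : nat * nat * bool) : nat * nat * bool :=
  (seq.index t.1.1 P, seq.index t.1.2 P, t.2).

(* [P] lists the positions of the successive laps before the word is read. *)
Fixpoint codeP (P : seq nat) (w : word) : code :=
  if w is l :: w' then
    (if letter_ends l is Some t then [:: place P t] else [::])
      ++ codeP (map (strand_swap (letter_index l)) P) w'
  else [::].

Definition word_code (m : nat) (w : word) : code :=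
  codeP (traject (track w) 1 m) w.

Lemma codeP_cat P w1 w2 :
  codeP P (w1 ++ w2) = codeP P w1 ++ codeP (map (track w1) P) w2.
Proof.
elim: w1 P => [|l w1 IH] P /=; first by rewrite map_id_in.
by rewrite IH -map_comp catA.
Qed.

Definition crossings (w : word) : seq nat :=
  [seq j <- iota 0 (size w) | isSome (letter_ends (nth (Virtual 0) w j))].

Definition crossing_ends (w : word) (j : nat) : nat * nat * bool :=
  odflt (0%N, 0%N, true) (letter_ends (nth (Virtual 0) w j)).

(** Closed form of the recursion through the prefixes [take j w], the form in which [lap] locates
    the endpoints of [word_chords]. *)
Lemma codePE P w : codeP P w =
  [seq place (map (track (take j w)) P) (crossing_ends w j) | j <- crossings w].
Proof.
elim: w P => [|l w IH] P //=; rewrite IH /crossings /= (iotaDl 1 0) filter_map.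
pose g j := place [seq track (take j (l :: w)) i | i <- P] (crossing_ends (l :: w) j).
pose js := [seq (1 + j)%N | j <- crossings w].
transitivity [seq g j | j <- if isSome (letter_ends l) then 0%N :: js else js]; last by [].
have gjs : [seq g j | j <- js] = [seq place [seq track (take j w) i
    | i <- [seq strand_swap (letter_index l) i | i <- P]] (crossing_ends w j)
    | j <- crossings w].
  by rewrite -map_comp; apply: eq_map => j; rewrite /g /= -map_comp.
case lE : (letter_ends l) => [t|] /=; rewrite gjs //; congr (_ :: _).
by rewrite /g /crossing_ends /= lE /= map_id_in.
Qed.

Lemma word_chord_ends (R : realType) m w j : word_chord R m w j =
  omap (fun t => (word_point R m w j t.1.1, word_point R m w j t.1.2))
    (letter_ends (nth (Virtual 0) w j)).
Proof. by rewrite /word_chord; case: (nth _ w j) => [i []|]. Qed.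

Lemma word_point_cpt (R : realType) m w j p : (0 < m)%N -> (j < size w)%N ->
  word_point R m w j p = cpt m ((lap m w j p)%:R + j%:R / (size w)%:R).
Proof.
move=> m0 jw; rewrite /word_point /cpt; congr circ.
rewrite natrD !natrM; field.
by rewrite !pnatr_eq0 -!lt0n m0 (leq_ltn_trans _ jw).
Qed.

(** The chord of letter [j] lies over the angle [j / size w], so reading the word from left to right
    lists the chords by increasing angle. *)
Lemma word_has_code (R : realType) m w : in_W1 m w ->
  has_code m (word_code m w) (word_gauss R m w).
Proof.
move=> hw; have m0 := hw.1.1.
rewrite /word_gauss; case: pselect => // hw'.
set e := word_code m w; pose js := crossings w.
have eE : e = [seq (lap m w j (crossing_ends w j).1.1,
    lap m w j (crossing_ends w j).1.2, (crossing_ends w j).2) | j <- js].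
  by rewrite /e /word_code codePE.
have se : size e = size js by rewrite eE size_map.
pose J (k : 'I_(size e)) := nth 0%N js k.
have Jin k : J k \in js by rewrite mem_nth // -se.
have JS k : (J k < size w)%N.
  by have := Jin k; rewrite mem_filter mem_iota => /andP[_].
have ujs : uniq js by rewrite filter_uniq ?iota_uniq.
have Jinj : injective J.
  move=> k l /eqP; rewrite nth_uniq ?se // => [/eqP/val_inj//||].
    by rewrite -se.
  by rewrite -se.
have JP k : letter_ends (nth (Virtual 0) w (J k)) = Some (crossing_ends w (J k)).
  have := Jin k; rewrite mem_filter /crossing_ends => /andP[+ _].
  by case: letter_ends.
pose ep (p : 'I_(size e) * bool) :=
  if p.2 then (crossing_ends w (J p.1)).1.1 else (crossing_ends w (J p.1)).1.2.
have epP k : [/\ (0 < ep (k, true) <= m)%N, (0 < ep (k, false) <= m)%N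
    & ep (k, true) != ep (k, false)].
  have := all_nthP (Virtual 0) hw.1.2 _ (JS k); have := JP k; rewrite /ep /=.
  by case: (nth _ w _) => [i []|] //= [<-] /= ?; split; lia.
have ep_in p : (0 < ep p <= m)%N by case: p => k []; case: (epP k).
have nthE k : (k < size js)%N -> nth (0%N, 0%N, true) e k =
    (lap m w (nth 0%N js k) (crossing_ends w (nth 0%N js k)).1.1,
     lap m w (nth 0%N js k) (crossing_ends w (nth 0%N js k)).1.2,
     (crossing_ends w (nth 0%N js k)).2).
  by move=> kj; rewrite eE (nth_map 0%N).
have lapE p : code_lap p = lap m w (J p.1) (ep p).
  rewrite /code_lap nthE -?se // /ep /J; by case: p.2.
have L0 (k : 'I_(size e)) : 0 < (size w)%:R :> R by rewrite ltr0n (leq_ltn_trans _ (JS k)).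
exists (fun k => (J k)%:R / (size w)%:R); split.
- move=> k l kl; rewrite ler_pM2r ?invr_gt0 ?(L0 k) // ler_nat.
  have sj : sorted leq js.
    by apply: sorted_filter; [exact: leq_trans|exact: iota_sorted].
  by apply: (sorted_leq_nth leq_trans leqnn) => //; rewrite inE -se.
- move=> k l; apply: (@lt_le_trans _ _ 1).
    by rewrite ltr_pdivrMr ?(L0 k) // mul1r ltr_nat.
  by rewrite lerDr divr_ge0 ?ler0n.
have cptE p : cpt m ((code_lap p)%:R + (J p.1)%:R / (size w)%:R) =
    word_point R m w (J p.1) (ep p).
  by rewrite word_point_cpt // lapE.
have chE k : word_chord R m w (J k) =
    Some (word_point R m w (J k) (ep (k, true)), word_point R m w (J k) (ep (k, false))).
  by rewrite word_chord_ends JP.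
split=> //=.
- move=> p q; rewrite /= !cptE => /(word_point_inj hw).
  case=> // /Jinj; case: p q => [k b] [l b'] /= <-.
  have [_ _] := epP k; move=> nk; case: b b' => -[] //= e1.
    by rewrite e1 eqxx in nk.
  by rewrite e1 eqxx in nk.
- move=> k; rewrite !cptE in_fset mem_pmap -chE; apply: map_f.
  by rewrite mem_iota /=.
- move=> c; rewrite in_fset mem_pmap => /mapP[j].
  rewrite mem_iota /= add0n => jw cE.
  have jjs : j \in js.
    rewrite mem_filter mem_iota jw /= andbT.
    by move: cE; rewrite word_chord_ends; case: letter_ends.
  have kP : (index j js < size e)%N by rewrite se index_mem.
  exists (Ordinal kP); have JE : J (Ordinal kP) = j by rewrite /J nth_index.
  by have := chE (Ordinal kP); rewrite !cptE {1}JE -cE => -[].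
- move=> k; rewrite !cptE /word_sign.
  have sE : code_sign k = (crossing_ends w (J k)).2.
    by rewrite /code_sign nthE -?se.
  rewrite sE; have crE j : (if nth (Virtual 0) w j is Crossing _ true then true else false)
      = (if letter_ends (nth (Virtual 0) w j) is Some t then t.2 else false).
    by case: (nth _ w j) => [i []|].
  apply/hasP/idP => [[j]|sk].
    rewrite mem_iota /= add0n => jw; rewrite crE word_chord_ends => /andP[].
    case lj : letter_ends => [[[p q] s]|] //= s1.
    move=> /eqP/(congr1 (fun o => if o is Some d then d.1 else 0)) /= e1.
    have p_in : (0 < p <= m)%N.
      have := all_nthP (Virtual 0) hw.1.2 _ jw.
      by case: (nth _ w j) lj => [i []|] //= [<-] _ _; lia.
    have [jJ _] := word_point_inj hw p_in (ep_in (k, true)) jw (JS k) e1.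
    by move: lj; rewrite jJ JP => -[->].
  exists (J k); first by rewrite mem_iota /=.
  by rewrite crE JP sk chE eqxx.
Qed.

(** * Realization of codes by words *)

Lemma strand_swapr i : strand_swap i i.+1 = i.
Proof. by rewrite /strand_swap gtn_eqF // eqxx. Qed.

Lemma strand_swap_neq i p : p != i -> p != i.+1 -> strand_swap i p = p.
Proof. by rewrite /strand_swap => /negbTE -> /negbTE ->. Qed.

Lemma trackK w : cancel (track w) (track (rev w)).
Proof. by have := track_revK (rev w); rewrite revK. Qed.

Lemma track_inj w : injective (track w).
Proof. exact: can_inj (trackK w). Qed.

Lemma track_cat w1 w2 p : track (w1 ++ w2) p = track w2 (track w1 p).
Proof. by rewrite /track foldl_cat. Qed.

Definition indices_in (m : nat) (w : word) : bool :=
  all (fun l => 0 < letter_index l < m)%N w.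

Lemma indices_in_cat m w1 w2 :
  indices_in m (w1 ++ w2) = indices_in m w1 && indices_in m w2.
Proof. exact: all_cat. Qed.

Lemma indices_in_rev m w : indices_in m (rev w) = indices_in m w.
Proof. exact: all_rev. Qed.

(* The positions taken by the successive laps at a given time. *)
Definition placement (m : nat) (P : seq nat) : bool :=
  [&& uniq P, size P == m & all (fun p => 0 < p <= m)%N P].

Lemma placement_map m P w : indices_in m w -> placement m P ->
  placement m (map (track w) P).
Proof.
move=> mw /and3P[uP sP aP]; apply/and3P; split.
- by rewrite map_inj_uniq //; exact: track_inj.
- by rewrite size_map.
- by rewrite all_map; apply: sub_all aP => p; exact: track_bound.
Qed.

Lemma placement_iota m : placement m (iota 1 m).
Proof.
apply/and3P; split; rewrite ?iota_uniq ?size_iota //.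
by apply/allP => p; rewrite mem_iota; lia.
Qed.

Lemma placement_mem m P p : placement m P -> (p \in P) = (0 < p <= m)%N.
Proof.
move=> /and3P[uP /eqP sP /allP aP].
have [||_ ->] := uniq_min_size uP (s2 := iota 1 m).
- by move=> q /aP; rewrite mem_iota; lia.
- by rewrite sP size_iota.
- by rewrite mem_iota; lia.
Qed.

Lemma codeP_virtual P s : codeP P (map Virtual s) = [::].
Proof. by elim: s P => //= i s IH P; exact: IH. Qed.

(** Selection sort: the descending letters [v_(p-1), ..., v_(r+1)] bring [p] down to [r + 1], and
    the remaining positions are then sorted with indices above [r + 1], which leave that position
    alone. *)
Lemma virtual_sort m r P : uniq P -> all (fun p => r < p <= m)%N P ->
  exists s, all (fun i => r < i < m)%N s /\
    map (track (map Virtual s)) P = iota r.+1 (size P).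
Proof.
move nE : (size P) => n; elim: n P nE r => [|n IH] [|p P] //= nE r.
  by exists [::].
move=> /andP[pP uP] /andP[rpm aP].
have [s1 [s1m s1p]] : exists s, all (fun i => r < i < m)%N s /\
    track (map Virtual s) p = r.+1.
  have [d pE] : exists d, p = (r.+1 + d)%N by exists (p - r.+1)%N; lia.
  elim: d p pE rpm {pP} => [|d IHd] p pE rpm.
    by exists [::]; rewrite pE addn0.
  have [||s [sm sp]] := IHd p.-1; [lia|lia|].
  exists (p.-1 :: s); rewrite /= sm andbT; split; first lia.
  rewrite -[RHS]sp /track /=; congr foldl.
  by rewrite -[in LHS](ltn_predK (n := p) (m := 0)) ?strand_swapr //; lia.
have rest : all (fun p => r.+1 < p <= m)%N (map (track (map Virtual s1)) P).
  rewrite all_map; apply/allP => q qP /=.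
  have qm := allP aP q qP.
  have ge : (r < track (map Virtual s1) q <= m)%N.
    elim: (s1) s1m (q) qm => //= i t IHt /andP[im tm] k km; apply: IHt => //.
    by rewrite /strand_swap; case: (k =P i) => [?|?]; [|case: (k =P i.+1) => ?]; lia.
  have : track (map Virtual s1) q <> r.+1.
    by rewrite -s1p => /track_inj qp; rewrite -qp qP in pP.
  lia.
case: nE => nE; have [|||s2 [s2m s2P]] := IH (map (track (map Virtual s1)) P) _ r.+1.
- by rewrite size_map.
- by rewrite map_inj_uniq //; exact: track_inj.
- exact: rest.
exists (s1 ++ s2); rewrite all_cat s1m /=; split.
  by apply: sub_all s2m => i; lia.
rewrite map_cat track_cat s1p; congr (_ :: _).
  elim: (s2) s2m => //= i t IHt /andP[im tm]; rewrite -[RHS]IHt //.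
  by rewrite /track /=; by rewrite strand_swap_neq //; lia.
rewrite -s2P -map_comp; apply: eq_map => q /=.
by rewrite track_cat.
Qed.

Lemma indices_virtual m s : indices_in m (map Virtual s) = all (fun i => 0 < i < m)%N s.
Proof. by rewrite /indices_in all_map. Qed.

(** Sort [P], then undo the sorting of [Q]; virtual letters are involutive, so reversing the word
    inverts it. *)
Lemma virtual_transport m P Q : uniq P -> uniq Q -> size P = size Q ->
  all (fun p => 0 < p <= m)%N P -> all (fun p => 0 < p <= m)%N Q ->
  exists s, indices_in m (map Virtual s) /\ map (track (map Virtual s)) P = Q.
Proof.
move=> uP uQ sPQ aP aQ.
have [s [sm sP]] := virtual_sort uP aP; have [t [tm tQ]] := virtual_sort uQ aQ.
exists (s ++ rev t); rewrite indices_virtual all_cat sm all_rev tm; split=> //.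
rewrite map_cat map_rev.
rewrite -[LHS]/(map _ P) (eq_map (track_cat _ _)) map_comp sP sPQ -tQ.
by rewrite mapK //; exact: trackK.
Qed.

Definition proper_code (m : nat) (e : code) : bool :=
  all (fun t => [&& t.1.1 < m, t.1.2 < m & t.1.1 != t.1.2])%N e.

(** One block per chord: virtual letters bring its two laps to positions [1] and [2], a crossing
    creates the chord, [v_1] undoes the exchange, and the virtual letters are run backwards. Each
    block acts trivially on positions, so blocks can be concatenated. *)
Lemma realize_code m P e : placement m P -> proper_code m e ->
  exists w, [/\ indices_in m w, map (track w) P = P & codeP P w = e].
Proof.
move=> pP; elim: e => [|[[a b] s] e IH] /=.
  by exists [::]; split=> //; rewrite map_id_in.
move=> /andP[/and3P[/= am bm ab] /IH[w2 [w2m w2P w2e]]].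
have /and3P[uP /eqP sP aP] := pP.
(* The tail enters [sigma_1] at position [1], but its inverse at position [2]. *)
pose Q := if s then [:: 1; 2]%N else [:: 2; 1]%N.
have [|||||t [tm tQ]] := @virtual_transport m [:: nth 0%N P a; nth 0%N P b] Q.
- by rewrite /= inE nth_uniq ?sP // ab.
- by rewrite /Q; case: (s).
- by rewrite /Q; case: (s).
- by rewrite /= !(allP aP) // mem_nth // sP.
- by rewrite /Q; case: (s) => /=; lia.
have m2 : (1 < m)%N by lia.
pose B := map Virtual t ++ [:: Crossing 1 s; Virtual 1] ++ rev (map Virtual t).
have BP : map (track B) P = P.
  apply: map_id_in => p _; rewrite /B !track_cat [track [:: _; _] _]/track /=.
  by rewrite strand_swapK trackK.
exists (B ++ w2); split.
- by rewrite !indices_in_cat indices_in_rev tm w2m /= m2.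
- by rewrite (eq_map (track_cat _ _)) map_comp BP.
rewrite codeP_cat BP w2e /B codeP_cat codeP_virtual /= -map_rev codeP_virtual.
have idx c : (c < m)%N ->
    seq.index (track (map Virtual t) (nth 0%N P c)) (map (track (map Virtual t)) P) = c.
  by move=> cm; rewrite index_map ?index_uniq ?sP //; exact: track_inj.
move: tQ (idx _ am) (idx _ bm); rewrite /Q.
by case: (s) => /= -[-> ->]; rewrite /place /= => -> ->.
Qed.

Lemma rot1_nth (T : Type) (x0 : T) (P : seq T) i : (i < size P)%N ->
  nth x0 (rot 1 P) i = nth x0 P (i.+1 %% size P).
Proof.
case: P => // p P /= iP; rewrite rot1_cons nth_rcons.
case: ltngtP => [iP'|iP'|->]; last by rewrite modnn.
- by rewrite modn_small.
- by move: iP; rewrite ltnS leqNgt iP'.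
Qed.

(** The equality [map (track w) P = rot 1 P] says that each lap ends where the next one starts, so
    the orbit of [1] runs through the whole of [P]. *)
Lemma placement_traject m w P : (0 < m)%N -> indices_in m w -> placement m P ->
  head 0%N P = 1%N -> map (track w) P = rot 1 P ->
  in_W1 m w /\ traject (track w) 1 m = P.
Proof.
move=> m0 wm pP hP wP; have /and3P[uP /eqP sP aP] := pP.
have step i : (i < m)%N -> track w (nth 0%N P i) = nth 0%N P (i.+1 %% m).
  by move=> im; rewrite -(nth_map _ 0%N) ?sP // wP rot1_nth sP.
have iterP k i : (i < m)%N -> iter k (track w) (nth 0%N P i) = nth 0%N P ((i + k) %% m).
  move=> im; elim: k => [|k IH]; first by rewrite addn0 modn_small.
  by rewrite iterS IH step ?ltn_pmod // -addn1 modnDml addn1 addnS.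
split.
- split=> // p q; rewrite -!(placement_mem _ pP) => pP1 qP1.
  have ip : (index p P < m)%N by rewrite -sP index_mem.
  have iq : (index q P < m)%N by rewrite -sP index_mem.
  exists (index q P + m - index p P)%N.
  have := iterP (index q P + m - index p P)%N _ ip.
  rewrite nth_index // subnKC; last by lia.
  by rewrite modnDr modn_small // nth_index.
- apply: (@eq_from_nth _ 0%N); rewrite size_traject ?sP // => i im.
  rewrite [LHS](set_nth_default 1%N) ?size_traject // nth_traject //.
  have := iterP i _ m0; rewrite nth0 hP => ->.
  by rewrite add0n modn_small.
Qed.

(** A word realizing the code brings every lap back to its own starting position; appended virtual
    letters, which add no chord, connect each lap to the next. *)
Lemma word_of_code m e : (0 < m)%N -> proper_code m e ->
  exists w, [/\ in_W1 m w, map (track w) (iota 1 m) = rot 1 (iota 1 m)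
    & codeP (iota 1 m) w = e].
Proof.
move=> m0 em; have pi := placement_iota m.
have [w1 [w1m w1P w1e]] := realize_code pi em.
have /and3P[u1 _ a1] := pi.
have [||||s [sm sP]] := @virtual_transport m (iota 1 m) (rot 1 (iota 1 m)) u1.
- by rewrite rot_uniq.
- by rewrite size_rot.
- exact: a1.
- by apply/allP => p; rewrite mem_rot => /(allP a1).
exists (w1 ++ map Virtual s).
have mP : map (track (w1 ++ map Virtual s)) (iota 1 m) = rot 1 (iota 1 m).
  by rewrite (eq_map (track_cat _ _)) map_comp w1P.
split=> //.
- have [||[]//] := @placement_traject m (w1 ++ map Virtual s) _ m0 _ pi _ mP.
  + by rewrite indices_in_cat w1m sm.
  + by case: (m) m0.
- by rewrite codeP_cat w1e w1P codeP_virtual cats0.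
Qed.

(** * Words in the shape required by relations (3) and (2) *)

Lemma letter_endsP m l t : (0 < letter_index l < m)%N -> letter_ends l = Some t ->
  (0 < t.1.1 <= m)%N && (0 < t.1.2 <= m)%N.
Proof. by case: l => [i []|] //= ? [<-] /=; lia. Qed.

Lemma index_strand_swap i p P :
  seq.index p (map (strand_swap i) P) = seq.index (strand_swap i p) P.
Proof.
rewrite -{1}(strand_swapK i p) index_map //.
exact: inv_inj (@strand_swapK i).
Qed.

(** A word acts on positions only, so another placement merely renames the laps. *)
Lemma codeP_relabel m f P P' w : indices_in m w ->
  (forall p, (0 < p <= m)%N -> seq.index p P' = f (seq.index p P)) ->
  codeP P' w = [seq (f t.1.1, f t.1.2, t.2) | t <- codeP P w].
Proof.
elim: w P P' => //= l w IH P P' /andP[lm wm] PP'; rewrite map_cat; congr (_ ++ _).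
  case lE: (letter_ends l) => [t|] //=.
  have /andP[t1 t2] := letter_endsP lm lE.
  by rewrite /place !PP'.
apply: IH => // p pm; rewrite !index_strand_swap PP' //.
by have := @track_bound m [:: l] p; apply; rewrite //= lm.
Qed.

Lemma size_codeP P w : size (codeP P w) = count (fun l => isSome (letter_ends l)) w.
Proof.
elim: w P => //= l w IH P; rewrite size_cat IH.
by case: letter_ends.
Qed.

Lemma iota_rcons i n : iota i n.+1 = rcons (iota i n) (i + n)%N.
Proof. by rewrite -[n.+1]addn1 iotaD cats1. Qed.

(* [sigma_m w] and [v_m w] insert a new lap, the one entering at position
   [m + 1], just before the lap entering at position [m]. *)
Definition skip_lap (m a : nat) : nat := if (m.-1 <= a)%N then a.+1 else a.

(** A first letter of index [m] sends the lap entering at [m] to position [m + 1], which [w] never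
    touches, and the following lap takes over its role in [w]. For the word starting with [sigma_m]
    only the number of chords matters. *)
Lemma stabilized_words m e : (0 < m)%N -> proper_code m e ->
  exists w, [/\ in_W1 m w,
    in_W1 m.+1 (Virtual m :: w) /\ in_W1 m.+1 (Crossing m true :: w), word_code m w = e,
    word_code m.+1 (Virtual m :: w) =
      [seq (skip_lap m t.1.1, skip_lap m t.1.2, t.2) | t <- e]
    & size (word_code m.+1 (Crossing m true :: w)) = (size e).+1].
Proof.
move=> m0 em; have [w [w1 wP we]] := word_of_code m0 em.
have wm : indices_in m w := w1.1.2.
have [_ tw] : in_W1 m w /\ traject (track w) 1 m = iota 1 m.
  by apply: placement_traject => //; [exact: placement_iota|case: (m) m0].
have wm1 : indices_in m.+1 w by apply: sub_all wm => l; lia.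
have fix_m1 : track w m.+1 = m.+1.
  elim: (w) wm => //= l t IH /andP[lm tm]; rewrite -[RHS]IH // /track /=.
  by rewrite strand_swap_neq //; lia.
have io : iota 1 m.+1 = rcons (iota 1 m) m.+1 by rewrite iota_rcons add1n.
have ioE : iota 1 m = rcons (iota 1 m.-1) m.
  by rewrite -{1}(ltn_predK m0) iota_rcons add1n (ltn_predK m0).
have swE : map (strand_swap m) (iota 1 m.+1) = rcons (rcons (iota 1 m.-1) m.+1) m.
  rewrite io ioE !map_rcons strand_swapr; congr (rcons (rcons _ _) _).
    by rewrite map_id_in // => p; rewrite mem_iota => ?; rewrite strand_swap_neq //; lia.
  by rewrite /strand_swap eqxx.
have m1E l : letter_index l = m ->
    map (track (l :: w)) (iota 1 m.+1) = rot 1 (iota 1 m.+1).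
  move=> lE.
  have -> : map (track (l :: w)) (iota 1 m.+1) = map (track w) (rcons (rcons (iota 1 m.-1) m.+1) m).
    by rewrite -swE -map_comp; apply: eq_map => p; rewrite /track /= lE.
  have rotE n : rot 1 (iota 1 n.+1) = rcons (iota 2 n) 1%N by rewrite /= rot1_cons.
  have i2 : iota 2 m = rcons (iota 2 m.-1) m.+1.
    by rewrite -{1}(ltn_predK m0) iota_rcons add2n (ltn_predK m0).
  move: wP; rewrite rotE i2 -{2}(ltn_predK m0) rotE ioE !map_rcons fix_m1.
  by move=> /rcons_inj[-> ->].
have in1 l : letter_index l = m ->
    in_W1 m.+1 (l :: w) /\ traject (track (l :: w)) 1 m.+1 = iota 1 m.+1.
  move=> lE; apply: placement_traject => //; last exact: m1E.
    by rewrite /indices_in /= lE m0 leqnn.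
  exact: placement_iota.
have [v1 v2] := in1 (Virtual m) erefl; have [s1 s2] := in1 (Crossing m true) erefl.
have we' : word_code m w = e by rewrite /word_code tw.
exists w; split=> //.
- have -> : word_code m.+1 (Virtual m :: w) =
      codeP (map (strand_swap m) (iota 1 m.+1)) w by rewrite /word_code v2.
  rewrite swE -we'.
  rewrite /word_code; apply: (codeP_relabel (f := skip_lap m) wm) => p pm.
  rewrite tw ioE -!cats1 !index_cat mem_cat mem_seq1.
  have -> : (p \in iota 1 m.-1) = (p < m)%N by rewrite mem_iota; lia.
  case: ltnP => [pm'|mp] /=.
    have : (seq.index p (iota 1 m.-1) < m.-1)%N.
      by rewrite -[X in (_ < X)%N](size_iota 1) index_mem mem_iota; lia.
    by rewrite /skip_lap => ?; case: leqP => //; lia.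
  have -> : p = m by lia.
  by rewrite eqxx (ltn_eqF (ltnSn m)) size_cat !size_iota /= !addn0 addn1 /skip_lap leqnn.
- by rewrite /word_code s2 size_codeP /= -(size_codeP (iota 1 m)) we.
Qed.

(** The last lap ends at position [1], where lap [0] starts, and a final crossing of index [1]
    involves that position: hence a tail in lap [m.-1]. In [v_1 sigma_1^-1] the virtual letter first
    exchanges the two laps, and the over-strand enters at position [2]; the chord thus keeps its
    direction and only its sign changes. *)
Lemma crossing_words m b e : (b < m.-1)%N -> proper_code m e ->
  exists w, [/\ in_W1 m w,
    [/\ in_W1 m (w ++ [:: Crossing 1 true; Virtual 1]),
        in_W1 m (w ++ [:: Virtual 1; Crossing 1 false])
      & in_W1 m (w ++ [:: Crossing 1 true; Crossing 1 false])],
    word_code m (w ++ [:: Crossing 1 true; Virtual 1]) = rcons e (m.-1, b, true),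
    word_code m (w ++ [:: Virtual 1; Crossing 1 false]) = rcons e (m.-1, b, false)
    & size (word_code m (w ++ [:: Crossing 1 true; Crossing 1 false])) = (size e).+2].
Proof.
move=> bm em; have m0 : (0 < m)%N by lia.
have m1 : (1 < m)%N by lia.
have mP : (m.-1 < m)%N by lia.
have bm' : (b < m)%N by lia.
have pi := placement_iota m; have /and3P[u1 /eqP z1 a1] := pi.
have [|||||s [sm sP]] := @virtual_transport m [:: m; b.+1] [:: 1; 2]%N.
- by rewrite /= inE andbT; lia.
- by [].
- by [].
- by rewrite /= andbT; lia.
- by rewrite /= andbT; lia.
pose Q := map (track (map Virtual s)) (iota 1 m).
have pQ : placement m Q by exact: placement_map.
have /and3P[uQ /eqP zQ aQ] := pQ.
have Q1 : nth 0%N Q m.-1 = 1%N.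
  rewrite (nth_map 0%N) ?nth_iota ?size_iota //.
  by rewrite add1n (ltn_predK m0); case: sP.
have Qb : nth 0%N Q b = 2%N.
  rewrite (nth_map 0%N) ?nth_iota ?size_iota //.
  by case: sP.
(* Each lap ends where the next one starts, so the starting positions are the final ones rotated
   back by one. *)
pose P := rotr 1 Q.
have PQ : rot 1 P = Q by rewrite rotrK.
have pP : placement m P.
  apply/and3P; split; rewrite ?rotr_uniq ?size_rotr ?zQ //.
  by apply/allP => p; rewrite mem_rotr => /(allP aQ).
have P1 : head 0%N P = 1%N.
  rewrite -nth0 -Q1 -PQ rot1_nth ?size_rotr ?zQ //.
  by rewrite (ltn_predK m0) modnn.
have /and3P[uP /eqP zP aP] := pP.
have [w1 [w1m w1P w1e]] := realize_code pP em.
have [|||t [tm tP]] := @virtual_transport m P Q uP uQ.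
- by rewrite zP zQ.
- exact: aP.
- exact: aQ.
exists (w1 ++ map Virtual t); set w := w1 ++ _.
have wm : indices_in m w by rewrite indices_in_cat w1m tm.
have wQ : map (track w) P = Q by rewrite (eq_map (track_cat _ _)) map_comp w1P.
have ends x y : letter_index x = 1%N -> letter_index y = 1%N ->
    in_W1 m (w ++ [:: x; y]) /\ word_code m (w ++ [:: x; y]) = e ++ codeP Q [:: x; y].
  move=> x1 y1; have [||wW tw] := @placement_traject m (w ++ [:: x; y]) P m0 _ pP P1.
  - by rewrite indices_in_cat wm /= x1 y1 m1.
  - rewrite PQ -[RHS]wQ; apply: eq_map => p.
    by rewrite track_cat /track /= x1 y1 strand_swapK.
  - split=> //; rewrite /word_code tw codeP_cat wQ; congr (_ ++ _).
    by rewrite codeP_cat codeP_virtual cats0.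
have idx c p : (c < m)%N -> nth 0%N Q c = p -> seq.index p Q = c.
  by move=> cm <-; rewrite index_uniq ?zQ.
have i1 : seq.index 1%N Q = m.-1 by apply: idx.
have i2 : seq.index 2%N Q = b by apply: idx.
have [wW _] : in_W1 m w /\ traject (track w) 1 m = P.
  by apply: placement_traject => //; rewrite wQ PQ.
have [W1 e1] := ends (Crossing 1 true) (Virtual 1) erefl erefl.
have [W2 e2] := ends (Virtual 1) (Crossing 1 false) erefl erefl.
have [W3 e3] := ends (Crossing 1 true) (Crossing 1 false) erefl erefl.
split=> //.
- by rewrite e1 /= /place /= i1 i2 cats1.
- by rewrite e2 /= /place /= !index_strand_swap i1 i2 cats1.
- by rewrite e3 size_cat /= addn2.
Qed.

(** * Relations in U *)

Section Relations.
Variables (R : realType) (n : nat).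
Implicit Types (D : gauss_diagram R).
Local Notation U := (U R n).

Lemma U_class_equiv D D' : gd_equiv D D' -> U_class n D = U_class n D'.
Proof.
move=> e; rewrite /U_class /gd_gen; congr (\pi_U << _ >>).
by apply/eqmodP/asboolP.
Qed.

Lemma pi_U_relator r : relator n r -> \pi_U r = 0 :> U.
Proof.
move=> rr; rewrite -[0](raddf0 (\pi_U : {additive _ -> U})).
apply/eqP; rewrite -Quotient.idealrBE subr0.
by apply/asboolP => Q _ _; apply.
Qed.

Lemma U_class_large D : (n < #|` chords (diagram D)|)%N -> U_class n D = 0.
Proof. by move=> nD; apply: pi_U_relator; exact: rel_large. Qed.

Lemma U_class_two m w i : in_W1 m w -> (0 < i < m)%N ->
  U_class n (word_gauss R m (w ++ [:: Crossing i true; Crossing i false]))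
  + U_class n (word_gauss R m (w ++ [:: Crossing i true; Virtual i]))
  + U_class n (word_gauss R m (w ++ [:: Virtual i; Crossing i false])) = 0.
Proof.
move=> wW im; rewrite /U_class -!(raddfD (\pi_U : {additive _ -> U})).
by apply: pi_U_relator; exact: rel_two.
Qed.

Lemma U_class_stab m w : in_W1 m w ->
  U_class n (word_gauss R m.+1 (Crossing m true :: w))
  + U_class n (word_gauss R m.+1 (Virtual m :: w))
  - U_class n (word_gauss R m w) = 0.
Proof.
move=> wW; rewrite /U_class -(raddfD (\pi_U : {additive _ -> U})).
rewrite -(raddfB (\pi_U : {additive _ -> U})).
by apply: pi_U_relator; exact: rel_stab.
Qed.

Lemma U_class_gen (H : set U) : H 0 ->
  (forall x y, H x -> H y -> H (x - y)) ->
  (forall D, H (U_class n D)) -> forall x, H x.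
Proof.
move=> H0 HB HU x.
have HN y : H y -> H (- y) by move=> Hy; rewrite -sub0r; exact: HB.
have HD y z : H y -> H z -> H (y + z).
  by move=> Hy Hz; rewrite -[z]opprK; apply: HB => //; exact: HN.
rewrite -[x]reprK -[repr x]freeg_sumE.
rewrite (raddf_sum (\pi_U : {additive _ -> U})) /=.
apply: big_ind => // z _; rewrite -[coeff _ _]intz -freegU_mulz.
rewrite (raddfMz (\pi_U : {additive _ -> U})) /=.
have Hz : H (\pi_U << z >>).
  by have := HU (repr z); rewrite /U_class /gd_gen /GD_class reprK.
have Hn k : H (\pi_U << z >> *+ k).
  by elim: k => [|k IH]; rewrite ?mulr0n // mulrS; exact: HD.
by case: (coeff _ _) => k; [exact: Hn|apply: HN; exact: Hn].
Qed.
End Relations.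

(** * Reduction to unitary diagrams *)

Section Laps.
Variable R : realType.
Implicit Types (m : nat) (I : finType).

(** The endpoints of a chord differ by an integer, hence have the same fractional part: the angle of
    the chord. *)
Lemma lap_decomposition m I (y : I * bool -> R) :
  (forall p, 0 <= y p < m%:R) ->
  (forall i, exists k : int, y (i, false) = y (i, true) + k%:~R) ->
  exists (a : I * bool -> nat) (theta : I -> R),
    [/\ forall p, y p = (a p)%:R + theta p.1, forall p, (a p < m)%N
      & forall i, 0 <= theta i < 1].
Proof.
move=> ym yk.
pose a p := `|Num.floor (y p)|%N.
have aE p : (a p)%:R = (Num.floor (y p))%:~R :> R.
  rewrite /a natr_absz ger0_norm // floor_ge0.
  by case/andP: (ym p).
have fl p : 0 <= y p - (a p)%:R < 1.
  have := floor_itv (y p); rewrite aE rmorphD /= => /andP[? ?]; lra.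
exists a, (fun i => y (i, true) - (a (i, true))%:R); split.
- move=> [i []] /=; first by ring.
  have [k e] := yk i; rewrite aE e.
  have -> : Num.floor (y (i, true) + k%:~R) = Num.floor (y (i, true)) + k.
    by rewrite floorDrz ?intr_int // intrKfloor.
  by rewrite rmorphD /= aE; ring.
- move=> p; rewrite -(ltr_nat R); have := fl p; have := ym p.
  by move=> /andP[? ?] /andP[? ?]; lra.
- by move=> i; exact: fl.
Qed.

Lemma rep_shift m I (x : I * bool -> R) s a D : rep m x s D ->
  exists2 D', rep m (fun p => x p + a) s D' & gd_equiv D D'.
Proof.
move=> rD; have m0 := rep_index_gt0 rD.
have [||D' rD'] := @rep_exists R m I (fun p => x p + a) s m0.
- move=> p q /(cpt_eq m0)[k e]; have [_ ix _ _ _] := rD; apply: ix => /=.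
  by rewrite -(cpt_add (x p) k m0); congr cpt; lra.
- by move=> i; have [k ->] := rep_int i rD; exists k; ring.
- by exists D' => //; exact: rep_rotate rD rD'.
Qed.

(** The enumeration [r] is a parameter because ties between angles may be broken at will; the sign
    reversal needs a prescribed chord to come last. *)
Lemma rep_has_code m I (x : I * bool -> R) s D (r : seq I)
    (a : I * bool -> nat) (theta : I -> R) :
  rep m x s D -> uniq r -> (forall i, i \in r) ->
  (forall p, cpt m (x p) = cpt m ((a p)%:R + theta p.1)) ->
  (forall i j, theta i < theta j + 1) ->
  sorted (fun i j => theta i <= theta j) r ->
  has_code m [seq (a (i, true), a (i, false), s i) | i <- r] D.
Proof.
move=> rD ur rI xE sp sr.
set e := map _ _.
have se : size e = size r by rewrite size_map.
pose f (k : 'I_(size e)) := tnth (in_tuple r) (cast_ord se k).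
have fn k i0 : f k = nth i0 r k by rewrite /f (tnth_nth i0).
have fi : injective f.
  have /tuple_uniqP ti : uniq (in_tuple r) by [].
  by move=> k l /ti/cast_ord_inj.
have fb : bijective f.
  apply: (inj_card_bij fi); rewrite card_ord se.
  have /card_uniqP <- := ur.
  by apply: subset_leq_card; apply/fintype.subsetP => i _; exact: rI.
have lapE p : code_lap p = a (f p.1, p.2).
  case: p => k b; rewrite /code_lap /= /e (nth_map (f k)) -?se // -fn.
  by case: b.
have rf := rep_reindex fb rD.
exists (theta \o f); split=> [k l kl|k l|]; last first.
- apply: rep_congr rf => [p|k] /=; first by rewrite xE lapE.
  by rewrite /code_sign /= /e (nth_map (f k)) -?se // -fn.
- exact: sp.
- pose i0 := f k; rewrite /= (fn k i0) (fn l i0).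
  apply: (sorted_leq_nth (leT := fun i j => theta i <= theta j)) => //.
  + by move=> ? ? ?; exact: le_trans.
  + by rewrite inE -se.
  + by rewrite inE -se.
Qed.

Lemma rep_proper_code m I (x : I * bool -> R) s D (r : seq I)
    (a : I * bool -> nat) (theta : I -> R) :
  rep m x s D ->
  (forall p, cpt m (x p) = cpt m ((a p)%:R + theta p.1)) ->
  (forall p, a p < m)%N ->
  proper_code m [seq (a (i, true), a (i, false), s i) | i <- r].
Proof.
move=> [_ ix _ _ _] xE am; apply/allP => _ /mapP[i _ ->] /=.
rewrite !am /=; apply/eqP => e.
by have /= := @ix (i, true) (i, false); rewrite !xE e => /(_ erefl) [].
Qed.

Lemma proper_code_in m e : proper_code m e -> code_in m e.
Proof. by apply: sub_all => t /and3P[-> ->]. Qed.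

End Laps.

(* [H] plays the role of a subgroup of U containing all diagrams with more than
   [k] chords; the lemmas compare diagrams with [k] chords modulo [H]. *)
Section Step.
Variables (R : realType) (n k : nat) (H : set (U R n)).
Hypothesis H0 : H 0.
Hypothesis HB : forall x y, H x -> H y -> H (x - y).
Hypothesis Hk : forall D : gauss_diagram R,
  (k < #|` chords (diagram D)|)%N -> H (U_class n D).
Implicit Types (D : gauss_diagram R) (m : nat) (I : finType).

Let HN x : H x -> H (- x).
Proof. by move=> Hx; rewrite -sub0r; exact: HB. Qed.

Let HD x y : H x -> H y -> H (x + y).
Proof. by move=> Hx Hy; rewrite -[y]opprK; apply: HB => //; exact: HN. Qed.

(** Comparing memberships rather than classes modulo [H] absorbs the change of sign produced by
    relation (2). *)
Definition same_mod D D' := H (U_class n D) <-> H (U_class n D').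

Lemma same_mod_equiv D1 D1' D2 D2' : gd_equiv D1 D2 -> gd_equiv D1' D2' ->
  same_mod D2 D2' -> same_mod D1 D1'.
Proof. by rewrite /same_mod => /(U_class_equiv n) -> /(U_class_equiv n) ->. Qed.

(** In relation (3) the term [sigma_m w] has [k + 1] chords, hence lies in [H]. *)
Lemma stabilize_code m e D D' : (0 < m)%N -> proper_code m e -> size e = k ->
  has_code m e D ->
  has_code m.+1 [seq (skip_lap m t.1.1, skip_lap m t.1.2, t.2) | t <- e] D' ->
  same_mod D D'.
Proof.
move=> m0 em ek De D'e.
have [w [w1 [v1 s1] we ve se]] := stabilized_words m0 em.
have e'in : code_in m.+1 [seq (skip_lap m t.1.1, skip_lap m t.1.2, t.2) | t <- e].
  apply/allP => _ /mapP[t te ->] /=.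
  have /and3P[? ? _] := allP em t te.
  by rewrite /skip_lap; apply/andP; split; case: ifP; lia.
have wc := word_has_code R w1; rewrite we in wc.
have vc := word_has_code R v1; rewrite ve in vc.
have sc := word_has_code R s1.
apply: (same_mod_equiv (has_code_equiv (proper_code_in em) De wc)
  (has_code_equiv e'in D'e vc)).
have Hs : H (U_class n (word_gauss R m.+1 (Crossing m true :: w))).
  by apply: Hk; rewrite (has_code_card sc) se ek.
have := U_class_stab R n w1; rewrite /same_mod.
move: (U_class _ _) (U_class _ _) (U_class _ _) Hs => xw xv xs Hs /eqP.
rewrite subr_eq0 => /eqP <-; split=> [Hw|Hv]; last exact: HD.
by rewrite -[xv](addKr xs) addrC; exact: HB.
Qed.

(** In relation (2) the term with both crossings has [k + 1] chords, hence lies in [H]; the other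
    two terms are opposite modulo [H]. *)
Lemma flip_last_code m b e D D' : (b < m.-1)%N -> proper_code m e ->
  (size e).+1 = k -> has_code m (rcons e (m.-1, b, true)) D ->
  has_code m (rcons e (m.-1, b, false)) D' -> same_mod D D'.
Proof.
move=> bm em ek De D'e.
have [w [w1 [W1 W2 W3] e1 e2 e3]] := crossing_words bm em.
have ein s : code_in m (rcons e (m.-1, b, s)).
  by rewrite /code_in all_rcons -/(code_in m e) proper_code_in //= andbT; lia.
have c1 := word_has_code R W1; rewrite e1 in c1.
have c2 := word_has_code R W2; rewrite e2 in c2.
have c3 := word_has_code R W3.
apply: (same_mod_equiv (has_code_equiv (ein _) De c1) (has_code_equiv (ein _) D'e c2)).
have H3 : H (U_class n (word_gauss R m (w ++ [:: Crossing 1 true; Crossing 1 false]))).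
  by apply: Hk; rewrite (has_code_card c3) e3 -ek.
have := U_class_two R n w1 (i := 1) _; rewrite /same_mod => /(_ ltac:(lia)).
move: (U_class _ _) (U_class _ _) (U_class _ _) H3 => x2 x1 x3 H3 /eqP.
rewrite addr_eq0 => /eqP e12; split=> [Hx|Hx].
  by rewrite -[x2]opprK -e12; apply/HN/HD.
have -> : x1 = - x2 - x3 by rewrite -e12 addrC addKr.
by apply: HB => //; exact: HN.
Qed.

(** A rotation puts the tail of [i0] at the base point, read as the far end [m] of the circle: lap
    [m.-1], angle [1]. The chord can then be listed last with its tail in the last lap, the case of
    [flip_last_code]. *)
Lemma flip_chord m I (x : I * bool -> R) s s' i0 D D' : #|I| = k ->
  rep m x s D -> rep m x s' D' -> s i0 -> ~~ s' i0 ->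
  (forall i, i != i0 -> s i = s' i) -> same_mod D D'.
Proof.
move=> Ik rD rD' si0 si0' ss'; have m0 := rep_index_gt0 rD.
pose al := - x (i0, true).
have [D1 rD1 eD] := rep_shift al rD; have [D1' rD1' eD'] := rep_shift al rD'.
apply: (same_mod_equiv eD eD').
(* Floors of the opposite lifts amount to ceilings of the lifts: [- y] is [(m.-1 - a) + (1 - th)]
   modulo [m], so the lift [0] is read as lap [m.-1] with the largest angle [1]. *)
have /boolp.choice[y yP] p : exists y : R, 0 <= y < 0 + m%:R /\
    exists j : int, y = - (x p + al) + m%:R * j%:~R.
  by have [y ? ?] := cpt_window 0 (- (x p + al)) m0; exists y.
have m0' : 0 < m%:R :> R by rewrite ltr0n.
have y0 : y (i0, true) = 0.
  have [/andP[y1 y2] [j yj]] := yP (i0, true).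
  apply: (@cpt_inj R m 0); rewrite ?lexx ?y1 ?add0r //=; first by rewrite add0r in y2.
  by rewrite yj cpt_add // /al subrr oppr0.
have [a [th [yE am th01]]] : exists (a : I * bool -> nat) (theta : I -> R),
    [/\ forall p, y p = (a p)%:R + theta p.1, forall p, (a p < m)%N
      & forall i, 0 <= theta i < 1].
  apply: lap_decomposition => [p|i]; first by have [] := yP p; rewrite add0r.
  have [_ [j1 ->]] := yP (i, true); have [_ [j2 ->]] := yP (i, false).
  have [l ->] := rep_int i rD; exists (- l + m%:~R * j2 - m%:~R * j1).
  by rewrite !rmorphD !rmorphN !rmorphM /=; ring.
have [a0 th0] : a (i0, true) = 0%N /\ th i0 = 0.
  have := yE (i0, true); rewrite y0 /= => e.
  have := ler0n R (a (i0, true)); have := th01 i0 => /andP[? _] ?.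
  by split; [apply/eqP; rewrite -(pnatr_eq0 R); apply/eqP|]; lra.
pose a' p := (m.-1 - a p)%N; pose th' i := 1 - th i.
have xE p : cpt m (x p + al) = cpt m ((a' p)%:R + th' p.1).
  have [_ [j yj]] := yP p.
  have -> : x p + al = (a' p)%:R + th' p.1 + m%:R * (j - 1)%:~R.
    have -> : x p + al = - y p + m%:R * j%:~R by rewrite yj; ring.
    have -> : (a' p)%:R = m%:R - 1 - (a p)%:R :> R.
      rewrite /a' natrB; last by have := am p; lia.
      by congr (_ - _); rewrite -[in RHS](ltn_predK m0) -natr1 addrK.
    by rewrite yE /th' rmorphB /=; ring.
  by rewrite cpt_add.
pose r := rcons (sort (fun i j => th' i <= th' j) [seq i <- enum I | i != i0]) i0.
have ur : uniq r.
  by rewrite rcons_uniq mem_sort mem_filter eqxx sort_uniq filter_uniq ?enum_uniq.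
have rI i : i \in r.
  rewrite mem_rcons inE mem_sort mem_filter mem_enum.
  by case: eqVneq.
have sp i j : th' i < th' j + 1 by have := th01 i; have := th01 j; rewrite /th'; lra.
have sr : sorted (fun i j => th' i <= th' j) r.
  have tr : transitive (fun i j => th' i <= th' j) by move=> ? ? ?; exact: le_trans.
  rewrite (sorted_pairwise tr) pairwise_rcons -(sorted_pairwise tr).
  rewrite sort_sorted => [|i j]; last exact: le_total.
  rewrite andbT; apply/allP => i _; rewrite /th' th0; have := th01 i; lra.
have c1 := rep_has_code rD1 ur rI xE sp sr.
have c1' := rep_has_code rD1' ur rI xE sp sr.
have a'm p : (a' p < m)%N by rewrite /a'; lia.
have p1 := rep_proper_code r rD1 xE a'm.
have sz : size r = #|I| by rewrite -(rep_card rD1) (has_code_card c1) size_map.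
rewrite /r !map_rcons in c1 c1' p1.
rewrite /proper_code all_rcons /= in p1; have {p1} [/and3P[_ bm ab] pe] := andP p1.
have ta : a' (i0, true) = m.-1 by rewrite /a' a0 subn0.
have es : [seq (a' (i, true), a' (i, false), s' i)
    | i <- sort (fun i j => th' i <= th' j) [seq i <- enum I | i != i0]] =
  [seq (a' (i, true), a' (i, false), s i)
    | i <- sort (fun i j => th' i <= th' j) [seq i <- enum I | i != i0]].
  apply/eq_in_map => i; rewrite mem_sort mem_filter => /andP[ni _].
  by rewrite ss'.
rewrite es (negbTE si0') ta in c1'; rewrite si0 ta in c1.
apply: (flip_last_code _ pe _ c1 c1'); first by rewrite ta in ab; lia.
by rewrite size_map -Ik -sz size_rcons.
Qed.

(** The new unit lies between [m] and [m + 1], whereas stabilization inserts one just before the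
    last lap. Rotation by [-1] reconciles them: the points of [[0, 1[] become the last lap, and the
    new unit precedes it. *)
Lemma insert_end m I (x : I * bool -> R) s D D' : #|I| = k ->
  rep m x s D -> rep m.+1 x s D' -> (forall p, 0 <= x p < m%:R) -> same_mod D D'.
Proof.
move=> Ik rD rD' xm; have m0 := rep_index_gt0 rD.
have [D1 rD1 eD] := rep_shift (-1) rD; have [D1' rD1' eD'] := rep_shift (-1) rD'.
apply: (same_mod_equiv eD eD').
pose y p := if x p < 1 then x p + m%:R - 1 else x p - 1.
have [a [th [yE am th01]]] : exists (a : I * bool -> nat) (theta : I -> R),
    [/\ forall p, y p = (a p)%:R + theta p.1, forall p, (a p < m)%N
      & forall i, 0 <= theta i < 1].
  have m1 : 1 <= m%:R :> R by rewrite ler1n.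
  apply: lap_decomposition => [p|i].
    by rewrite /y; have := xm p; case: (ltP (x p) 1) => ? /andP[? ?]; apply/andP; split; lra.
  have [l e] := rep_int i rD; rewrite /y.
  case: ifP => _; case: ifP => _; rewrite e.
  - by exists l; ring.
  - by exists (l + m%:Z); rewrite rmorphD /=; ring.
  - by exists (l - m%:Z); rewrite rmorphB /=; ring.
  - by exists l; ring.
have xE p : cpt m (x p + -1) = cpt m ((a p)%:R + th p.1).
  rewrite -yE /y; case: ifP => // _.
  by rewrite -(cpt_add (x p + -1) 1 m0); congr cpt; ring.
have xE' p : cpt m.+1 (x p + -1) = cpt m.+1 ((skip_lap m (a p))%:R + th p.1).
  have mE : (m.-1)%:R = m%:R - 1 :> R by rewrite -{2}(ltn_predK m0) -natr1 addrK.
  have := yE p; rewrite /y /skip_lap; have := th01 p.1; have := xm p.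
  case: (ltP (x p) 1) => x1 /andP[? ?] /andP[? ?] yp; case: leqP => ap.
  - have -> : (a p).+1%:R + th p.1 = x p + -1 + m.+1%:R * 1%:~R.
      by rewrite -!natr1; lra.
    by rewrite cpt_add.
  - by exfalso; move: ap; rewrite -(ler_nat R) -natr1 mE; lra.
  - by exfalso; move: ap; rewrite -(ler_nat R) mE; lra.
  - by congr cpt; lra.
pose r := sort (fun i j => th i <= th j) (enum I).
have ur : uniq r by rewrite sort_uniq enum_uniq.
have rI i : i \in r by rewrite mem_sort mem_enum.
have sp i j : th i < th j + 1 by have := th01 i; have := th01 j; lra.
have sr : sorted (fun i j => th i <= th j) r.
  by apply: sort_sorted => i j; exact: le_total.
have c1 := rep_has_code rD1 ur rI xE sp sr.
have c1' := rep_has_code (a := fun p => skip_lap m (a p)) rD1' ur rI xE' sp sr.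
apply: (stabilize_code m0 (rep_proper_code r rD1 xE am) _ c1).
  by rewrite size_map -Ik -(rep_card rD1) (has_code_card c1) size_map.
by rewrite -map_comp.
Qed.

(** Rotating the cut point [c] to the origin reduces to [insert_end]. On the longer circle the
    rotation is by [- c - 1], since the points from [c] on have already moved by one unit. *)
Lemma insert_at m I (x : I * bool -> R) s c D D' : #|I| = k ->
  (forall p, 0 <= x p < m%:R) -> 0 <= c <= m%:R ->
  rep m x s D -> rep m.+1 (fun p => x p + (c <= x p)%R%:R) s D' -> same_mod D D'.
Proof.
move=> Ik xm cm rD rD'; have m0 := rep_index_gt0 rD.
have [D1 rD1 eD] := rep_shift (- c) rD; have [D1' rD1' eD'] := rep_shift (- c - 1) rD'.
apply: (same_mod_equiv eD eD').
pose y p := if c <= x p then x p - c else x p - c + m%:R.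
apply: (@insert_end m I y s) => //.
- apply: rep_congr rD1 => // p; rewrite /y; case: ifP => // _.
  by rewrite -(cpt_add (x p + - c) 1 m0) mulr1.
- apply: rep_congr rD1' => // p; rewrite /y; case: ifP => _ /=.
    by congr cpt; ring.
  rewrite -(cpt_add _ 1 (ltn0Sn m)); congr cpt; rewrite -natr1; ring.
- move=> p; rewrite /y; have := xm p; case: (leP c (x p)) => ? /andP[? ?].
    by apply/andP; split; lra.
  by apply/andP; split; lra.
Qed.

Lemma rep_window m I (x y : I * bool -> R) s t D m' : (0 < m')%N ->
  rep m x s D -> (forall p q, x p < x q -> y p < y q) ->
  (forall p, 0 <= y p < m'%:R) ->
  (forall i, exists j : int,
     y (i, false) - y (i, true) = x (i, false) - x (i, true) + j%:~R) ->
  exists D', rep m' y t D'.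
Proof.
move=> m0' rD xy ym yx; have [_ ix _ _ _] := rD.
apply: rep_exists => // [p q /= e|i].
  have {}e : y p = y q by apply: (@cpt_inj R m' 0) => //; rewrite add0r.
  apply: ix => /=; congr cpt; apply/eqP; apply: contra_eqT e => npq.
  by have := npq; rewrite neq_lt => /orP[]/xy; [move/lt_eqF->|move/gt_eqF->].
have [j e] := yx i; have [l e'] := rep_int i rD.
by exists (l + j); rewrite rmorphD /=; lra.
Qed.

(** Cuts are made from the largest to the smallest: units inserted at points beyond [c] do not
    change which endpoints lie at or after [c], so the remaining cuts keep their original
    coordinates. *)
Lemma insert_list m I (x : I * bool -> R) s (K : seq R) D : #|I| = k ->
  rep m x s D -> (forall p, 0 <= x p < m%:R) ->
  sorted <=%R K -> all (fun c => 0 <= c < m%:R) K ->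
  exists D', rep (m + size K) (fun p => x p + (count (<= x p) K)%:R) s D' /\
    same_mod D D'.
Proof.
move=> Ik rD xm; have m0 := rep_index_gt0 rD.
have bnd p (L : seq R) : 0 <= x p + (count (<= x p) L)%:R < (m + size L)%:R.
  have /andP[x0 xm'] := xm p.
  by rewrite addr_ge0 //= natrD ltr_leD // ler_nat; exact: count_size.
elim: K => [|c K IH] sK aK.
  exists D; split; last by [].
  by rewrite addn0; apply: rep_congr rD => // p; rewrite addr0.
have /= /andP[/andP[c0 cm] aK'] := aK.
have [D1 [rD1 s1]] := IH (path_sorted sK) aK'.
have cK d : d \in K -> c <= d by have /allP := order_path_min (@le_trans _ R) sK; exact.
have cle p : (c <= x p + (count (<= x p) K)%:R) = (c <= x p).
  case: leP => [|xc]; last first.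
    apply/esym/negbTE; rewrite -ltNge; apply: le_lt_trans xc.
    by rewrite lerDl ler0n.
  have [//|xc] := leP c (x p).
  suff -> : count (<= x p) K = 0%N by rewrite addr0 leNgt xc.
  apply/eqP; rewrite -leqn0 leqNgt -has_count; apply/hasPn => d /cK cd.
  by rewrite -ltNge; exact: lt_le_trans cd.
pose y p := x p + (count (<= x p) (c :: K))%:R.
have cmono p q : x p <= x q -> (count (<= x p) (c :: K) <= count (<= x q) (c :: K))%N.
  by move=> pq; apply: sub_count => d dp; exact: le_trans pq.
have [||||D2 rD2] := @rep_window m I x y s s D (m + size K).+1 _ rD.
- by [].
- by move=> p q pq; rewrite /y ltr_leD // ler_nat cmono // ltW.
- by move=> p; rewrite -addnS; exact: (bnd p (c :: K)).
- move=> i; exists ((count (<= x (i, false)) (c :: K))%:Z - (count (<= x (i, true)) (c :: K))%:Z).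
  by rewrite /y rmorphB /=; ring.
exists D2; rewrite /= addnS; split=> //.
have s2 : same_mod D1 D2.
  apply: (@insert_at (m + size K) I _ s c D1 D2 Ik _ _ rD1).
  - by move=> p; exact: bnd.
  - by rewrite c0 (le_trans (ltW cm)) // ler_nat leq_addr.
  - apply: rep_congr rD2 => // p; congr cpt; rewrite cle /y /= natrD; ring.
exact: iff_trans s1 s2.
Qed.

Lemma positive_signs m I (x : I * bool -> R) : #|I| = k ->
  (forall D, rep m x xpredT D -> H (U_class n D)) ->
  forall s D, rep m x s D -> H (U_class n D).
Proof.
move=> Ik HT s D; have [j] := ubnP #|[pred i | ~~ s i]|.
elim: j s D => // j IH s D sj rD; have m0 := rep_index_gt0 rD.
have [i0 /= si0|s1] := pickP [pred i | ~~ s i]; last first.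
  by apply: HT; apply: rep_congr rD => // i; have /negbFE := s1 i.
pose s' i := (i == i0) || s i.
have [||D' rD'] := @rep_exists R m I x s' m0.
- by case: rD.
- by move=> i; exact: rep_int rD.
have ss' i : i != i0 -> s' i = s i by rewrite /s' => /negbTE ->.
have s'i0 : s' i0 by rewrite /s' eqxx.
have [D'D _] := flip_chord Ik rD' rD s'i0 si0 ss'.
apply: D'D; apply: (IH s') rD'.
rewrite -ltnS; apply: leq_trans sj; rewrite ltnS; apply: proper_card; apply/properP; split.
  by apply/fintype.subsetP => i; rewrite !inE /s' negb_or => /andP[].
by exists i0; rewrite !inE // s'i0.
Qed.

Definition unit_index I : nat := if #|I| == 0%N then 1%N else (2 * #|I|)%N.

Lemma card_points I : #|{: I * bool}| = (2 * #|I|)%N.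
Proof. by rewrite card_prod card_bool mulnC. Qed.

(** As long as the index exceeds [unit_index I], the pigeonhole principle gives an integer point [g]
    that is not an endpoint; [insert_at], read backwards, removes one unit there. *)
Lemma remove_gaps m I (a : I * bool -> nat) : #|I| = k -> (0 < m)%N ->
  injective a -> (forall p, a p < m)%N ->
  (forall (b : I * bool -> nat) D, injective b -> (forall p, b p < unit_index I)%N ->
     rep (unit_index I) (fun p => (b p)%:R) xpredT D -> H (U_class n D)) ->
  forall D, rep m (fun p => (a p)%:R) xpredT D -> H (U_class n D).
Proof.
move=> Ik m0 ia am Hu; elim: m m0 a ia am => // m IH _ a ia am D rD.
pose f p := Ordinal (am p).
have fi : injective f by move=> p q /(congr1 val) /= /ia.
have leu : (unit_index I <= m.+1)%N.
  rewrite /unit_index; case: ifP => // _; rewrite -card_points -[m.+1]card_ord.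
  exact: leq_card fi.
move: leu; rewrite leq_eqVlt => /orP[/eqP um|ltu].
  by apply: (Hu a) => //; rewrite um.
have m0 : (0 < m)%N by move: ltu; rewrite /unit_index; case: eqP => //; lia.
have [g gm ga] : exists2 g, (g <= m)%N & forall p, a p != g.
  have lt2 : (2 * #|I| < m.+1)%N.
    by move: ltu; rewrite /unit_index; case: eqP => // ->.
  case: (pickP [pred g | g \notin codom f]) => [g /= gf|fo].
    exists g => [|p]; first by rewrite -ltnS.
    apply: contra gf => /eqP e; apply/codomP; exists p; exact/val_inj.
  move: lt2; rewrite -card_points ltnNge => /negP[].
  rewrite -(card_codom fi) -[X in (X <= _)%N]card_ord.
  apply: subset_leq_card; apply/fintype.subsetP => g _.
  by have /negbFE := fo g.
pose b p := if (g < a p)%N then (a p).-1 else a p.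
have ab p : a p = (b p + (g <= b p))%N.
  by have := ga p; rewrite /b; case: (ltngtP g (a p)) => //; lia.
have ib : injective b.
  by move=> p q e; apply: ia; rewrite !ab e.
have bm p : (b p < m)%N.
  by have := am p; have := ga p; rewrite /b; case: (ltngtP g (a p)) => //; lia.
have [||D' rD'] := @rep_exists R m I (fun p => (b p)%:R) xpredT m0.
- move=> p q /= e; apply: ib; apply/eqP; rewrite -(eqr_nat R); apply/eqP.
  by apply: (@cpt_inj R m 0) e; rewrite add0r ler0n ltr_nat bm.
- move=> i; exists ((b (i, false))%:Z - (b (i, true))%:Z).
  by rewrite rmorphB /=; ring.
have [D'D _] : same_mod D' D; last by apply: D'D; exact: (IH m0 b).
apply: (@insert_at m I _ xpredT g%:R D' D Ik _ _ rD').
- by move=> p; rewrite ler0n ltr_nat bm.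
- by rewrite ler0n ler_nat.
- by apply: rep_congr rD => // p; rewrite {1}ab natrD ler_nat.
Qed.

Lemma reduce_to_unit D : #|` chords (diagram D)| = k ->
  (forall I (b : I * bool -> nat) D', #|I| = k -> injective b ->
     (forall p, b p < unit_index I)%N ->
     rep (unit_index I) (fun p => (b p)%:R) xpredT D' -> H (U_class n D')) ->
  H (U_class n D).
Proof.
move=> Dk Hu; have [I [x [s [rD xm]]]] := rep_total D.
move: (braid_index D) rD xm => m rD xm.
have Ik : #|I| = k by rewrite -(rep_card rD).
apply: (positive_signs Ik _ rD) => {s D Dk rD} D rD.
pose K := sort <=%R [seq x p | p <- enum {: I * bool}].
have [||D1 [rD1 [_ D1D]]] := insert_list (K := K) Ik rD xm.
- by apply: sort_sorted => ? ?; exact: le_total.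
- by rewrite all_sort; apply/allP => _ /mapP[p _ ->]; exact: xm.
apply: D1D; set M := (m + size K)%N in rD1; set x1 := fun p => _ in rD1.
have xK p : x p \in K by rewrite mem_sort map_f ?mem_enum.
have x1M p : 0 <= x1 p < M%:R.
  have /andP[x0 xm'] := xm p; rewrite /x1 addr_ge0 //= natrD ltr_leD // ler_nat.
  exact: count_size.
(* The unit inserted at [x q] counts for [q] and not for [p], so gaps between endpoints now exceed
   one and their integer parts are distinct. *)
have x1lt p q : x p < x q -> x1 p + 1 < x1 q.
  move=> pq; have : (count (<= x p) K < count (<= x q) K)%N.
    have /permP pK := perm_to_rem (xK q).
    rewrite !pK /= lexx lt_geF // add0n add1n ltnS.
    by apply: sub_count => d dp; exact: le_trans dp (ltW pq).
  by rewrite -(ler_nat R) -natr1 /x1; lra.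
have [a [th [x1E aM th01]]] : exists (a : I * bool -> nat) (theta : I -> R),
    [/\ forall p, x1 p = (a p)%:R + theta p.1, forall p, (a p < M)%N
      & forall i, 0 <= theta i < 1].
  by apply: lap_decomposition => // i; exact: rep_int rD1.
have xlt p q : p != q -> x p < x q \/ x q < x p.
  move=> npq; apply/orP; rewrite -neq_lt; apply: contra_neq npq => e.
  by have [_ ix _ _ _] := rD; apply: ix; rewrite /= e.
have alt p q : x p < x q -> (a p < a q)%N.
  move=> /x1lt; rewrite !x1E -(ltr_nat R).
  by have := th01 p.1; have := th01 q.1; lra.
have ia : injective a.
  move=> p q e; apply/eqP; apply: contra_eqT e => /xlt[]/alt.
    by move/ltn_eqF ->.
  by move/gtn_eqF ->.
have x1x p q : x1 p < x1 q -> x p < x q.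
  have [->|/xlt[//|/x1lt]] := eqVneq p q; first by rewrite ltxx.
  by lra.
have M0 := rep_index_gt0 rD1.
(* The slide to integer points: each chord moves back by its angle [th], both endpoints at once. *)
have [|||D2 rD2] := @rep_window M I x1 (fun p => (a p)%:R) xpredT xpredT D1 M M0 rD1.
- by move=> p q /x1x/alt; rewrite ltr_nat.
- by move=> p; rewrite ler0n ltr_nat aM.
- by move=> i; exists 0; rewrite !x1E /=; ring.
have e12 : gd_equiv D1 D2.
  apply: (rep_equiv rD1 rD2) => [p q|p q|p q /x1x/alt|i].
  - by have := x1M p; have := x1M q; lra.
  - by rewrite -natrD ltr_nat (leq_trans (aM p)) // leq_addl.
  - by rewrite ltr_nat.
  - by rewrite !x1E /=; ring.
rewrite (U_class_equiv n e12); apply: (remove_gaps Ik M0 ia aM _ rD2) => b D' ib bu.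
exact: Hu.
Qed.

End Step.

(** * Unitary diagrams *)

Section Unitary.
Variables (R : realType) (n : nat).
Implicit Types (D : gauss_diagram R) (I : finType).

(** The subgroup [H] is arbitrary so that the same induction serves both conclusions of the
    theorem. *)
Lemma U_generated (H : set (U R n)) : H 0 ->
  (forall x y, H x -> H y -> H (x - y)) ->
  (forall I (b : I * bool -> nat) D, (#|I| <= n)%N -> injective b ->
     (forall p, b p < unit_index I)%N ->
     rep (unit_index I) (fun p => (b p)%:R) xpredT D -> H (U_class n D)) ->
  forall x, H x.
Proof.
move=> H0 HB Hu; apply: U_class_gen => // D.
(* Induction on [j] is downward induction on the number of chords; at [j = 0] there are more than
   [n] chords and the class vanishes. *)
have [j] : exists j, (n < #|` chords (diagram D)| + j)%N.
  by exists n.+1; rewrite addnS ltnS leq_addl.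
elim: j D => [|j IH] D nj; first by rewrite U_class_large // -[X in (_ < X)%N]addn0.
have [nD|Dn] := ltnP n #|` chords (diagram D)|; first by rewrite U_class_large.
apply: (@reduce_to_unit R n #|` chords (diagram D)| H) => // [D' DD'|I b D' Ik].
  by apply: IH; lia.
by apply: Hu; rewrite Ik.
Qed.

Lemma rep_endpoint m I (x : I * bool -> R) s D z : rep m x s D ->
  (endpoint (diagram D) z <-> exists p, z = cpt m (x p)).
Proof.
move=> [_ _ xD Dx _]; split=> [[_ /Dx[i ->]]|[[i b] ->]].
  by rewrite !inE => /orP[] /eqP ->; [exists (i, true)|exists (i, false)].
exists (cpt m (x (i, true)), cpt m (x (i, false))); first exact: xD.
by rewrite !inE; case: b; rewrite eqxx ?orbT.
Qed.

(** Counting: as many endpoints as integer points on the circle, so every integer point is an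
    endpoint. *)
Lemma unit_points_onto I (b : I * bool -> nat) : injective b ->
  (forall p, b p < unit_index I)%N -> (0 < #|I|)%N ->
  forall j, exists p, b p = (j %% unit_index I)%N.
Proof.
move=> ib bM I0 j; have M0 : (0 < unit_index I)%N.
  by rewrite /unit_index; case: ifP => // _; lia.
pose f p := Ordinal (bM p).
have fi : injective f by move=> p q /(congr1 val) /= /ib.
have fb : bijective f.
  by apply: (inj_card_bij fi); rewrite card_ord card_points /unit_index; case: ifP; lia.
have [g _ gK] := fb; exists (g (Ordinal (ltn_pmod j M0))).
by have := congr1 val (gK (Ordinal (ltn_pmod j M0))).
Qed.

Lemma unit_index_gt0 I : (0 < unit_index I)%N.
Proof. by rewrite /unit_index; case: eqP => //; lia. Qed.

Lemma cpt_mod m (j : nat) : (0 < m)%N -> cpt m (j %% m)%N%:R = cpt m j%:R :> Cplx R.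
Proof.
move=> m0; rewrite [in RHS](divn_eq j m) natrD natrM addrC mulrC.
by rewrite -(cpt_add _ (j %/ m)%:Z m0).
Qed.

Section Standard.
Variables (I : finType) (b : I * bool -> nat) (D : gauss_diagram R).
Let M := unit_index I.
Hypothesis ib : injective b.
Hypothesis bM : forall p, (b p < M)%N.
Hypothesis rD : rep M (fun p => (b p)%:R) xpredT D.

Let M0 : (0 < M)%N := unit_index_gt0 I.

Lemma standard_endpoint j : (0 < #|I|)%N -> endpoint (diagram D) (cpt M j%:R).
Proof.
move=> I0; have [p bp] := unit_points_onto ib bM I0 j.
by apply/(rep_endpoint _ rD); exists p; rewrite bp cpt_mod.
Qed.

(** Endpoints are integer points, so their distance is an integer; were it at least two, the point
    one unit after the first would be an endpoint in between. *)
Lemma standard_unitary : unitary D.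
Proof.
have [eI _ _ Dx sD] := rD; split.
- by rewrite (rep_card rD).
- by move=> c /Dx[i ->].
- move=> z t /andP[t0 t1] /(rep_endpoint _ rD)[p ->] /(rep_endpoint _ rD)[q e] nb.
  have I0 : (0 < #|I|)%N by apply/card_gt0P; exists p.1.
  have M0' : 0 < M%:R :> R by rewrite ltr0n.
  have Mt (r : R) : cpt M (b p)%:R * circ r = cpt M ((b p)%:R + M%:R * r).
    by rewrite /cpt -circD; congr circ; field; exact: lt0r_neq0.
  rewrite Mt in e; have [j ej] := cpt_eq M0 e.
  have : exists l : int, M%:R * t = l%:~R.
    exists ((b q)%:Z - (b p)%:Z - M%:Z * j).
    by rewrite !rmorphB rmorphM /=; lra.
  move=> [l lE]; rewrite eI lE.
  have l0 : (0 < l)%R by rewrite -(ltr0z R) -lE mulr_gt0.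
  have [l1|l1] := leP l 1; first by have -> : l = 1 by lia.
  exfalso; apply: (nb M%:R^-1).
    rewrite invr_gt0 M0' /= -(ltr_pM2l M0') divff ?lt0r_neq0 // lE.
    by rewrite (ltr_int R 1).
  rewrite Mt divff ?lt0r_neq0 // natr1; exact: standard_endpoint.
Qed.

(** The diagram picked by [unitary_of] is known only through its properties. Being unitary forces
    the lift [F] of the homeomorphism to have increment [1 / M] between consecutive grid points, so
    on endpoints it is the translation by [F 0], and the two diagrams differ by a rotation. *)
Lemma unitary_standard D1 : unitary D1 ->
  cd_equiv (diagram D) (diagram D1) -> gd_equiv D D1.
Proof.
move=> [eI1 s1 adj] [f [[g [_ _ fK gK]] [F [[G [_ _ FK GK]] iF fF]]] eC].
have [eI ix xD Dx sD] := rD.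
have finj x y : S1 x -> S1 y -> f x = f y -> x = y.
  by move=> /fK[_ fx] /fK[_ fy] e; rewrite -fx e fy.
have card1 : #|` chords (diagram D1)| = #|I|.
  rewrite eC -(rep_card rD); apply: card_in_imfset => c d cD dD /=.
  have [c1 c2 _] := chords_wf cD; have [d1 d2 _] := chords_wf dD.
  case: c d cD dD c1 c2 d1 d2 => [c1 c2] [d1 d2] /= _ _ ? ? ? ? e.
  congr (_, _); apply: finj => //; [exact: (congr1 fst e)|exact: (congr1 snd e)].
have eM1 : braid_index D1 = M by rewrite eI1 card1.
have end1 z : endpoint (diagram D1) z <-> exists p, z = f (cpt M (b p)%:R).
  split=> [[c]|[[i c] ->]].
    rewrite eC => /imfsetP[_ /Dx[i ->] ->]; rewrite !inE => /orP[]/eqP->.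
      by exists (i, true).
    by exists (i, false).
  exists (f (cpt M (b (i, true))%:R), f (cpt M (b (i, false))%:R)).
    by rewrite eC; apply/imfsetP; eexists; [exact: xD i|].
  by rewrite !inE; case: c; rewrite eqxx ?orbT.
have fE p : f (cpt M (b p)%:R) = cpt M ((b p)%:R + M%:R * F 0).
  have I0 : (0 < #|I|)%N by apply/card_gt0P; exists p.1.
  have M1 : (1 < M)%N by rewrite /M /unit_index; case: eqP => //; lia.
  have M0' : 0 < M%:R :> R by rewrite ltr0n.
  have FE (j : nat) : F (j%:R / M%:R) = F 0 + j%:R / M%:R.
    elim: j => [|j IH]; first by rewrite mul0r addr0.
    set t0 := j%:R / M%:R in IH *; set t1 := j.+1%:R / M%:R.
    have t01 : t1 = t0 + M%:R^-1 by rewrite /t1 -natr1 mulrDl mul1r.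
    have iM : 0 < (M%:R^-1 : R) < 1 by rewrite invr_gt0 M0' invf_lt1 // ltr1n.
    pose t := F t1 - F t0.
    have FF : F t0 < F t1 by apply: iF; lra.
    (* The arc from [t0] to [t1] has length [1 / M < 1], so an injective map cannot return to its
       initial value along it. *)
    have gap y : t0 < y <= t1 -> f (circ y) <> f (circ t0).
      move=> /andP[y0 y1] /finj e.
      have [j' ej] := circ_eq (esym (e (circ_S1 _) (circ_S1 _))).
      have : (0 < j')%R by rewrite -(ltr0z R); lra.
      by rewrite -[(0 < j')%R]/(1 <= j')%R -(ler_int R); lra.
    have iF' y z : F y < F z -> y < z.
      rewrite !ltNge; apply: contra; rewrite le_eqVlt.
      by move=> /predU1P[->//|/iF/ltW].
    have FGK y : F (G y) = y by case: (GK y).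
    (* Otherwise [F] would reach [F t0 + 1] by the time [t1], contradicting [gap]. *)
    have tlt1 : t < 1.
      rewrite ltNge; apply/negP => t1'; apply: (gap (G (F t0 + 1))).
        rewrite iF' ?FGK ?ltrDl ?ltr01 //= leNgt; apply/negP => /iF.
        by rewrite FGK; move: t1'; rewrite /t; lra.
      by rewrite !fF FGK (circDint _ 1).
    have ends j' : endpoint (diagram D1) (circ (F (j'%:R / M%:R))).
      have /(rep_endpoint _ rD)[p' ep] := standard_endpoint j' I0.
      by apply/end1; exists p'; rewrite -ep /cpt fF.
    have Ft1 : F t1 = F t0 + t by rewrite /t; ring.
    have := adj (circ (F t0)) t; rewrite eM1 -circD -Ft1 => Mt.
    have {}Mt : M%:R * t = 1.
      apply: Mt; [by rewrite subr_gt0 FF|exact: ends|exact: ends|].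
      (* An endpoint strictly in between would come from an integer strictly between [j] and
         [j + 1]. *)
      move=> r /andP[r0 rt]; rewrite -circD => /end1[q].
      set y := G (F t0 + r); have -> : F t0 + r = F y by rewrite FGK.
      have t0y : t0 < y by apply: iF'; rewrite FGK; lra.
      have yt1 : y < t1 by apply: iF'; rewrite FGK Ft1; lra.
      rewrite -fF => /finj e.
      have [l el] := circ_eq (e (circ_S1 _) (circ_S1 _)).
      have yM : y * M%:R = ((b q)%:Z - M%:Z * l)%:~R.
        rewrite rmorphB rmorphM /=.
        have -> : y = (b q)%:R / M%:R - l%:~R by lra.
        by field; exact: lt0r_neq0.
      move: t0y yt1; rewrite -(ltr_pM2r M0') -(ltr_pM2r M0' y) yM.
      rewrite !divfK ?lt0r_neq0 // -[j%:R]/(j%:Z%:~R) -[j.+1%:R]/(j.+1%:Z%:~R).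
      by rewrite !ltr_int; lia.
    rewrite Ft1 IH -addrA t01; congr (_ + (_ + _)).
    by apply: (mulfI (lt0r_neq0 M0')); rewrite Mt divff ?lt0r_neq0.
  rewrite {1}/cpt fF FE /cpt; congr circ; field; exact: lt0r_neq0.
have rD1 : rep M (fun p => (b p)%:R + M%:R * F 0) xpredT D1.
  split=> //.
  - move=> p q /=; rewrite -!fE => /finj e; apply: ix; apply: e; exact: circ_S1.
  - by move=> i; rewrite -!fE eC; apply/imfsetP; eexists; [exact: xD i|].
  - by move=> c; rewrite eC => /imfsetP[_ /Dx[i ->] ->]; exists i; rewrite /= !fE.
  - move=> i; rewrite s1 // -!fE eC; apply/imfsetP; eexists; [exact: xD i|by []].
exact: rep_rotate rD rD1.
Qed.

End Standard.
End Unitary.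

(** * Values of [u] and a finite list of representatives *)

Lemma unitary_ofP (R : realType) (I : finType) (b : I * bool -> nat) (D : gauss_diagram R) :
  injective b -> (forall p, b p < unit_index I)%N ->
  rep (unit_index I) (fun p => (b p)%:R) xpredT D ->
  gd_equiv D (unitary_of (CD_class (diagram D))).
Proof.
move=> ib bM rD.
have [un cE] : [set D' | unitary D' /\ CD_class (diagram D') = CD_class (diagram D)]
    (unitary_of (CD_class (diagram D))).
  by apply: getPex; exists D; split=> //; exact: standard_unitary ib bM rD.
apply: (unitary_standard ib bM rD) => //.
by have /eqmodP/asboolP/cd_equiv_sym := cE.
Qed.

Lemma cd_equiv_card (R : realType) (c c' : chord_diagram R) :
  cd_equiv c c' -> #|` chords c'| = #|` chords c|.
Proof.
move=> [f [[g [_ _ fK _]] _] ->]; apply: card_in_imfset => d e dc ec /=.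
have [d1 d2 _] := chords_wf dc; have [e1 e2 _] := chords_wf ec.
have finj x y : S1 x -> S1 y -> f x = f y -> x = y.
  by move=> /fK[_ fx] /fK[_ fy] fxy; rewrite -fx fxy fy.
case: d e dc ec d1 d2 e1 e2 => [d1 d2] [e1 e2] /= _ _ ? ? ? ? e.
by congr (_, _); apply: finj => //; [exact: (congr1 fst e)|exact: (congr1 snd e)].
Qed.

Lemma CD_size_class (R : realType) (c : chord_diagram R) :
  CD_size (CD_class c) = #|` chords c|.
Proof.
have /eqmodP/asboolP e : \pi_(CD R) c = \pi_(CD R) (repr (CD_class c)) by rewrite reprK.
exact: cd_equiv_card e.
Qed.

Lemma u_standard (R : realType) n (I : finType) (b : I * bool -> nat) (D : gauss_diagram R) :
  (#|I| <= n)%N -> injective b -> (forall p, b p < unit_index I)%N ->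
  rep (unit_index I) (fun p => (b p)%:R) xpredT D ->
  exists x : AbCD R n, u x = U_class n D.
Proof.
move=> In ib bM rD.
have qn : (CD_size (CD_class (diagram D)) <= n)%N by rewrite CD_size_class (rep_card rD).
pose q : {q : CD R | (CD_size q <= n)%N} := exist (fun q => is_true (CD_size q <= n)%N) _ qn.
exists << q >>.
rewrite /u liftU scale1r /=; symmetry.
exact: U_class_equiv (unitary_ofP ib bM rD).
Qed.

(* Normal forms of the unitary diagrams: index [M], chords prescribed by [C]. *)
Definition grid_diagram (R : realType) (N M : nat) (C : {set 'I_N * 'I_N}) :
    gauss_diagram R :=
  get [set D | [/\ braid_index D = M,
    forall c, c \in chords (diagram D) <->
      exists2 p : 'I_N * 'I_N, p \in C & c = (cpt M p.1%:R, cpt M p.2%:R)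
    & forall c, c \in chords (diagram D) -> sign D c = true]].

(** The lifts are integers below [N], so the chords are recorded by one of finitely many sets of
    pairs; [D] itself shows that [get] meets its specification. *)
Lemma grid_diagramP (R : realType) N (I : finType) (b : I * bool -> nat) (D : gauss_diagram R) :
  (unit_index I <= N)%N -> (forall p, b p < unit_index I)%N ->
  rep (unit_index I) (fun p => (b p)%:R) xpredT D ->
  exists C : {set 'I_N * 'I_N}, gd_equiv D (grid_diagram R (unit_index I) C).
Proof.
move=> IN bM rD.
pose f p : 'I_N := widen_ord IN (Ordinal (bM p)).
pose C := [set (f (i, true), f (i, false)) | i : I]; exists C.
have [eI ix xD Dx sD] := rD.
have [eI' Dx' sD'] : [set D | [/\ braid_index D = unit_index I,
    forall c, c \in chords (diagram D) <->
      exists2 p : 'I_N * 'I_N, p \in C & c = (cpt (unit_index I) p.1%:R, cpt (unit_index I) p.2%:R)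
    & forall c, c \in chords (diagram D) -> sign D c = true]]
    (grid_diagram R (unit_index I) C).
  apply: getPex; exists D; split=> //.
    move=> c; split=> [/Dx[i ->]|[_ /imsetP[i _ ->] ->]]; last exact: xD.
    by exists (f (i, true), f (i, false)); rewrite ?imset_f.
  by move=> c /Dx[i ->]; exact: sD.
apply: (rep_unique rD).
have inD i : (cpt (unit_index I) (b (i, true))%:R, cpt (unit_index I) (b (i, false))%:R)
    \in chords (diagram (grid_diagram R (unit_index I) C)).
  by apply/Dx'; exists (f (i, true), f (i, false)); rewrite ?imset_f.
split=> //.
- by move=> c /Dx'[_ /imsetP[i _ ->] ->]; exists i.
- by move=> i; exact: sD'.
Qed.

Theorem theorem8 (R : realType) (n : nat) :
  (forall y : U R n, exists x : AbCD R n, u x = y)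
  /\ finitely_generated (U R n).
Proof.
split.
  apply: U_generated => [|x y [x' <-] [y' <-]|I b D In ib bM rD].
  - by exists 0; rewrite raddf0.
  - by exists (x' - y'); rewrite raddfB.
  - exact: u_standard In ib bM rD.
pose N := (2 * n).+1.
(* Pairs [(M, C)] that describe no diagram contribute the class of the default value of [get], a
   harmless extra generator. *)
pose s := [seq U_class n (grid_diagram R M C) |
  M <- iota 0 N.+1, C <- enum {: {set 'I_N * 'I_N}}].
exists s.
apply: U_generated => [|x y [a ->] [a' ->]|I b D In ib bM rD].
- by exists (fun=> 0); rewrite big1 // => i _; rewrite mulr0z.
- exists (fun i => a i - a' i); rewrite -sumrB.
  by apply: eq_bigr => i _; rewrite mulrzBr.
have IN : (unit_index I <= N)%N by rewrite /unit_index /N; case: ifP => // _; lia.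
have [C /(U_class_equiv n) ->] := grid_diagramP IN bM rD.
have Us : U_class n (grid_diagram R (unit_index I) C) \in s.
  by apply: allpairs_f; rewrite ?mem_enum // mem_iota.
have js : (seq.index (U_class n (grid_diagram R (unit_index I) C)) s < size s)%N.
  by rewrite index_mem.
(* The list may contain repetitions; the coefficient is the indicator of the first occurrence. *)
exists (fun i => (i == seq.index (U_class n (grid_diagram R (unit_index I) C)) s)%:Z).
rewrite (bigD1 (Ordinal js)) //= eqxx mulr1z nth_index // big1 ?addr0 // => i ni.
by rewrite (_ : (_ == _) = false) ?mulr0z //; apply/negbTE.
Qed.
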